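(* Let $R$ be a commutative Artinian ring with unit, with Jacobson radical $J(R)$, and let $\mathscr G$ be an ample groupoid (not necessarily Hausdorff) such that each isotropy group $G_u$, $u\in\mathscr G^{(0)}$, is either (i) finite, or (ii) locally finite abelian with the order of each of its elements invertible in $R/J(R)$. Then the primitive ideals of $R\mathscr G$ are precisely the annihilators of modules induced from simple modules of isotropy group rings, i.e., precisely the ideals $\mathrm{Ann}(\mathrm{Ind}_u(M))$ with $u\in\mathscr G^{(0)}$ and $M$ a simple $RG_u$-module.
   Context: Compactness includes the Hausdorff axiom; locally compact spaces are not required to be Hausdorff. A topological groupoid $\mathscr G=(\mathscr G^{(0)},\mathscr G^{(1)})$, with domain map $\boldsymbol d$ and range map $\boldsymbol r$ and product $\gamma\eta$ defined when $\boldsymbol d(\gamma)=\boldsymbol r(\eta)$, is étale if $\boldsymbol d$ is a local homeomorphism; objects are identified with identity arrows, so $\mathscr G^{(0)}$ is an open subspace of $\mathscr G^{(1)}$. An étale groupoid is ample if $\mathscr G^{(0)}$ is locally compact Hausdorff with a basis of compact open subsets ($\mathscr G^{(1)}$ need not be Hausdorff). Groupoid algebra: $R\mathscr G$ is the $R$-span in $R^{\mathscr G^{(1)}}$ of the characteristic functions $1_U$ of compact open (in particular Hausdorff) subsets $U\subseteq \mathscr G^{(1)}$, with convolution product $f\ast g(\gamma)=\sum_{\alpha\beta=\gamma}f(\alpha)g(\beta)$ (the sums are finite). It is an associative $R$-algebra with local units, not necessarily unital. Modules: a left module $M$ over a ring $S$ with local units is unitary if $SM=M$; for a unital ring this means $1m=m$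 for all $m$. A left $S$-module $M$ is simple if $SM\neq 0$ and $M$ has no proper non-zero submodules. An ideal is primitive if it is the annihilator of a simple left module. For a left $R\mathscr G$-module $M$, $\mathrm{Ann}(M)=\{f\in R\mathscr G\mid fM=0\}$. Induction: for $u\in\mathscr G^{(0)}$, $G_u=\{\gamma\in\mathscr G^{(1)}\mid \boldsymbol d(\gamma)=u=\boldsymbol r(\gamma)\}$ is the isotropy group at $u$ and $RG_u$ its group ring. Let $\mathscr Gu=\boldsymbol d^{-1}(u)$ and let $R\mathscr Gu$ be the free $R$-module on $\mathscr Gu$. It is an $R\mathscr G$-$RG_u$-bimodule: $G_u$ acts on the right by multiplication, and $f\in R\mathscr G$ acts on the left by $f\alpha=\sum_{\boldsymbol d(\gamma)=\boldsymbol r(\alpha)}f(\gamma)\gamma\alpha$ for $\alpha\in\mathscr Gu$. For a unitary left $RG_u$-module $M$, the induced module is the left $R\mathscr G$-module $\mathrm{Ind}_u(M)=R\mathscr Gu\otimes_{RG_u}M$. *)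

(* Defs.v *)
(* Written with MathComp and MathComp-Analysis. *)
From HB Require Import structures.
From mathcomp Require Import all_boot all_order all_algebra finmap all_classical.
From mathcomp Require Import topology numfun freeg.

Set Implicit Arguments.
Unset Strict Implicit.
Unset Printing Implicit Defensive.
Import GRing.Theory.
Local Open Scope classical_set_scope.
Local Open Scope ring_scope.

Section FreeModule.
Variables (R : comPzRingType) (K : choiceType).

Definition finsupp (f : K -> R^o) : bool :=
  `[< finite_set [set k | f k != 0] >].

Lemma finsupp_submod : subsemimod_closed finsupp.
Proof.
split; first split.
- apply/asboolP; rewrite (_ : [set _ | _] = set0)//.
  by rewrite -subset0 => k /=; rewrite eqxx.
- move=> f g /asboolP ff /asboolP fg; apply/asboolP.
  have : finite_set ([set k | f k != 0] `|` [set k | g k != 0]).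
    by rewrite finite_setU.
  apply: sub_finite_set => k /=.
  have [f0 fg0|] := eqVneq (f k) 0; last by left.
  by right; apply: contra_neq fg0 => g0; rewrite -[LHS]/(f k + g k) f0 g0 addr0.
- move=> a f /asboolP ff; apply/asboolP; apply: sub_finite_set ff => k /=.
  by apply: contra_neq => fk; rewrite -[LHS]/(a *: f k) fk scaler0.
Qed.

HB.instance Definition _ :=
  GRing.isSubmodClosed.Build R (K -> R^o) finsupp finsupp_submod.

(* The free R-module on the set K, as the functions of finite support. *)
Record fmod := Fmod { fmod_fun : K -> R^o; _ : finsupp fmod_fun }.

HB.instance Definition _ := [isSub for fmod_fun].
HB.instance Definition _ := [Choice of fmod by <:].
HB.instance Definition _ := [SubChoice_isSubLmodule of fmod by <:].

Definition fcoef (x : fmod) (k : K) : R := fmod_fun x k.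
#[global] Arguments fcoef : simpl never.
Coercion fcoef : fmod >-> Funclass.

Lemma fmod_eq (x y : fmod) : x =1 y -> x = y.
Proof. by move=> xy; apply/val_inj/funext. Qed.

Lemma fmod0E k : (0 : fmod) k = 0. Proof. by []. Qed.
Lemma fmodDE (x y : fmod) k : (x + y) k = x k + y k. Proof. by []. Qed.
Lemma fmodZE a (x : fmod) k : (a *: x) k = a * x k. Proof. by []. Qed.
Lemma fmod_sumE (I : Type) (r : seq I) (P : pred I) (F : I -> fmod) k :
  (\sum_(i <- r | P i) F i) k = \sum_(i <- r | P i) F i k.
Proof. exact: (big_morph (fun x : fmod => x k)). Qed.

Lemma fmod_finite (x : fmod) : finite_set [set k | x k != 0].
Proof. exact: (asboolW (valP x)). Qed.

Definition fsupp (x : fmod) : {fset K} := fset_set [set k | x k != 0].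

Lemma mem_fsupp x k : (k \in fsupp x) = (x k != 0).
Proof.
rewrite in_fset_set; last exact: fmod_finite.
by apply/idP/idP => [/set_mem//|xk]; exact/mem_set.
Qed.

Lemma finsupp_delta (k : K) : finsupp (fun l => (l == k)%:R).
Proof.
apply/asboolP; apply: (@sub_finite_set _ _ [set k]) => // l /=.
by have [->//|] := eqVneq l k; rewrite eqxx.
Qed.
Definition fdelta (k : K) : fmod := Fmod (finsupp_delta k).

Lemma fdeltaE k l : fdelta k l = (l == k)%:R. Proof. by []. Qed.

Section Linear.
Variable V : lmodType R.
Implicit Type F : K -> V.

(* The linear map extending F; the sum is over the finite support of x. *)
Definition flin F (x : fmod) : V := \sum_(k \in [set: K]) x k *: F k.

Lemma flinE F (x : fmod) (A : {fset K}) :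
  (forall k, x k != 0 -> k \in A) -> flin F x = \sum_(k <- A) x k *: F k.
Proof.
move=> xA; rewrite /flin (fsbigTE A)// => k /negP kA.
have [->|/xA//] := eqVneq (x k) 0; exact: scale0r.
Qed.

Lemma flin_is_linear F : linear (flin F).
Proof.
move=> a x y; pose A := (fsupp x `|` fsupp y)%fset.
have xA k : x k != 0 -> k \in A by rewrite -mem_fsupp in_fsetU => ->.
have yA k : y k != 0 -> k \in A by rewrite -mem_fsupp in_fsetU orbC => ->.
rewrite (flinE _ xA) (flinE _ yA) (@flinE _ _ A) => [|k]; last first.
  have [x0|/xA//] := eqVneq (x k) 0; have [y0|/yA//] := eqVneq (y k) 0.
  by rewrite fmodDE fmodZE x0 y0 mulr0 addr0 eqxx.
rewrite scaler_sumr -big_split; apply: eq_bigr => k _ /=.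
by rewrite fmodDE fmodZE scalerDl scalerA.
Qed.
HB.instance Definition _ F :=
  GRing.isLinear.Build R fmod V *:%R (flin F) (flin_is_linear F).

Lemma flin_delta F k : flin F (fdelta k) = F k.
Proof.
rewrite (@flinE _ _ [fset k]%fset) => [|l]; last first.
  by rewrite fdeltaE in_fset1; case: (l == k); rewrite // eqxx.
by rewrite big_seq_fset1 fdeltaE eqxx scale1r.
Qed.

Lemma eq_flin F G x : F =1 G -> flin F x = flin G x.
Proof. by move=> /funext ->. Qed.

Lemma flinD F G x : flin (fun k => F k + G k) x = flin F x + flin G x.
Proof.
have xA k : x k != 0 -> k \in fsupp x by rewrite -mem_fsupp.
rewrite !(flinE _ xA) -big_split; apply: eq_bigr => k _; exact: scalerDr.
Qed.

Lemma flinZ a F x : flin (fun k => a *: F k) x = a *: flin F x.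
Proof.
have xA k : x k != 0 -> k \in fsupp x by rewrite -mem_fsupp.
rewrite !(flinE _ xA) scaler_sumr; apply: eq_bigr => k _.
by rewrite !scalerA mulrC.
Qed.
End Linear.

Lemma fmod_expand x : x = \sum_(k <- fsupp x) x k *: fdelta k.
Proof.
apply: fmod_eq => k; rewrite fmod_sumE.
have [x0|x0] := eqVneq (x k) 0.
  rewrite x0 big1_seq// => l _; rewrite fmodZE fdeltaE.
  by have [<-|_] := eqVneq k l; rewrite ?x0 ?mul0r ?mulr0.
rewrite (big_fsetD1 k) ?mem_fsupp//= fmodZE fdeltaE eqxx mulr1 big1_seq ?addr0//.
move=> l /=; rewrite in_fsetD1 fmodZE fdeltaE [k == l]eq_sym.
by case: (l == k); rewrite ?mulr0.
Qed.

Lemma fmod_ext (V : lmodType R) (L L' : {linear fmod -> V}) :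
  (forall k, L (fdelta k) = L' (fdelta k)) -> L =1 L'.
Proof.
move=> LL' x; rewrite (fmod_expand x) !linear_sum; apply: eq_bigr => k _.
by rewrite !linearZ LL'.
Qed.

Lemma flin_comp (V W : lmodType R) (L : {linear V -> W}) (F : K -> V) x :
  L (flin F x) = flin (L \o F) x.
Proof.
have xA k : x k != 0 -> k \in fsupp x by rewrite -mem_fsupp.
rewrite !(flinE _ xA) linear_sum; apply: eq_bigr => k _; exact: linearZ.
Qed.

End FreeModule.

Lemma flin_swap (R : comPzRingType) (K K' : choiceType) (V : lmodType R)
    (F : K -> K' -> V) (x : fmod R K) (y : fmod R K') :
  flin (fun k => flin (F k) y) x = flin (fun l => flin (F^~ l) x) y.
Proof.
have xA k : x k != 0 -> k \in fsupp x by rewrite -mem_fsupp.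
have yA k : y k != 0 -> k \in fsupp y by rewrite -mem_fsupp.
rewrite !(flinE _ xA) !(flinE _ yA).
under eq_bigr do rewrite (flinE _ yA) scaler_sumr.
under [RHS]eq_bigr do rewrite (flinE _ xA) scaler_sumr.
rewrite exchange_big; apply: eq_bigr => l _; apply: eq_bigr => k _.
by rewrite !scalerA mulrC.
Qed.

Arguments fdelta {R K}.

(* The group ring RG: the free R-module on G with the bilinear extension of
   the group law. *)
Definition gring (R : comPzRingType) (G : groupType) : Type := fmod R G.

Section GroupRing.
Variables (R : comPzRingType) (G : groupType).

HB.instance Definition _ := GRing.Lmodule.on (gring R G).

Definition gring_mul (a b : gring R G) : gring R G :=
  flin (fun g => flin (fun h => fdelta (g * h)%g) b) a.

Lemma gring_mulDl : left_distributive gring_mul +%R.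
Proof. by move=> a b c; rewrite /gring_mul linearD. Qed.

Lemma gring_mulDr : right_distributive gring_mul +%R.
Proof.
move=> a b c; rewrite /gring_mul -flinD.
by apply: eq_flin => g; rewrite linearD.
Qed.

Lemma gring_mul_delta g h :
  gring_mul (fdelta g) (fdelta h) = fdelta (g * h)%g.
Proof. by rewrite /gring_mul !flin_delta. Qed.

Lemma gring_mul1l : left_id (fdelta 1%g) gring_mul.
Proof.
move=> a; rewrite /gring_mul flin_delta.
apply: (@fmod_ext _ _ _ (flin _) idfun) => g /=.
by rewrite flin_delta mul1g.
Qed.

Lemma gring_mul1r : right_id (fdelta 1%g) gring_mul.
Proof.
move=> a; apply: (@fmod_ext _ _ _ (flin _) idfun) => g /=.
by rewrite !flin_delta mulg1.
Qed.

Lemma gring_mulA : associative gring_mul.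
Proof.
move=> a b c; rewrite /gring_mul flin_comp; apply: eq_flin => g /=.
rewrite !flin_comp; apply: eq_flin => h /=.
rewrite flin_comp flin_delta; apply: eq_flin => k /=.
by rewrite flin_delta mulgA.
Qed.

HB.instance Definition _ := GRing.Zmodule_isPzRing.Build (gring R G)
  gring_mulA gring_mul1l gring_mul1r gring_mulDl gring_mulDr.

End GroupRing.

Section CommutativeRings.
Variable R : comPzRingType.

Definition ideal (I : set R) : Prop :=
  [/\ I 0, forall x y, I x -> I y -> I (x + y) & forall a x, I x -> I (a * x)].

Definition artinian : Prop :=
  forall I : nat -> set R, (forall n, ideal (I n)) ->
    (forall n, I n.+1 `<=` I n) ->
    exists n, forall m, (n <= m)%N -> I m = I n.

Definition maximal_ideal (I : set R) : Prop :=
  [/\ ideal I, I <> [set: R] &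
      forall J, ideal J -> I `<=` J -> J = I \/ J = [set: R]].

Definition jacobson_radical : set R := \bigcap_(I in maximal_ideal) I.

(* The class of x is a unit of the quotient ring R / I. *)
Definition unit_mod (I : set R) (x : R) : Prop := exists y, I (x * y - 1).

End CommutativeRings.

Arguments artinian : clear implicits.
Arguments jacobson_radical : clear implicits.

Section Groups.
Variable G : groupType.

Definition subgroup (H : set G) : Prop :=
  [/\ H 1%g, forall g h, H g -> H h -> H (g * h)%g &
      forall g, H g -> H (g^-1)%g].

Definition locally_finite : Prop :=
  forall F : set G, finite_set F -> finite_set (smallest subgroup F).

Definition has_order (g : G) (n : nat) : Prop :=
  [/\ (0 < n)%N, (g ^+ n)%g = 1%g &
      forall m, (0 < m)%N -> (g ^+ m)%g = 1%g -> (n <= m)%N].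

End Groups.

Arguments locally_finite : clear implicits.

(* Associative rings without a unit, and their left modules. *)
HB.mixin Record Zmodule_isRng S of GRing.Zmodule S := {
  rmul : S -> S -> S;
  rmulA : associative rmul;
  rmulDl : left_distributive rmul +%R;
  rmulDr : right_distributive rmul +%R
}.

#[short(type="rngType")]
HB.structure Definition Rng := {S of Zmodule_isRng S & GRing.Zmodule S}.

HB.mixin Record Zmodule_isRngModule (S : rngType) M of GRing.Zmodule M := {
  modact : S -> M -> M;
  modactA : forall a b m, modact (rmul a b) m = modact a (modact b m);
  modactDl : forall m, {morph modact^~ m : a b / a + b};
  modactDr : forall a, {morph modact a : m n / m + n}
}.

#[short(type="rngModType")]
HB.structure Definition RngModule (S : rngType) :=
  {M of Zmodule_isRngModule S M & GRing.Zmodule M}.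

Section Modules.
Variables (S M : zmodType) (act : S -> M -> M).

Definition submodule (N : set M) : Prop :=
  [/\ N 0, forall m n, N m -> N n -> N (m - n) &
      forall s m, N m -> N (act s m)].

(* For a ring S with unit and a unitary M, the first condition says M <> 0; in
   general it forces S M = M, since the elements killed by S and the span of
   S M are submodules. *)
Definition simple_module : Prop :=
  (exists s m, act s m <> 0) /\
  (forall N : set M, submodule N -> N = [set 0] \/ N = [set: M]).

Definition annihilator : set S := [set s | forall m, act s m = 0].

End Modules.

Definition two_sided_ideal (S : rngType) (I : set S) : Prop :=
  [/\ I 0, forall a b, I a -> I b -> I (a - b) &
      forall s a, I a -> I (rmul s a) /\ I (rmul a s)].

Definition primitive_ideal (S : rngType) (I : set S) : Prop :=
  two_sided_ideal I /\
  exists M : rngModType S,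
    simple_module (@modact S M) /\ I = annihilator (@modact S M).

(* The tensor product of a right S-module A (with action actA) and a left
   S-module M: the free abelian group on A * M modulo the subgroup generated by
   the usual relators. *)
Section Tensor.
Local Open Scope quotient_scope.
Variables (S : pzRingType) (A : zmodType) (actA : A -> S -> A) (M : lmodType S).

Notation F := {freeg (A * M)%type / int}.

Inductive tensor_rel : set F :=
| tensor_rel_Dl a b m :
    tensor_rel (<< (a + b, m) >> - << (a, m) >> - << (b, m) >>)
| tensor_rel_Dr a m n :
    tensor_rel (<< (a, m + n) >> - << (a, m) >> - << (a, n) >>)
| tensor_rel_bal a s m :
    tensor_rel (<< (actA a s, m) >> - << (a, s *: m) >>).

Definition tensor_ker : F -> bool := fun z =>
  `[< smallest (fun N : set F => N 0 /\ forall x y, N x -> N y -> N (x - y))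
        tensor_rel z >].

Lemma tensor_ker_zmod : zmod_closed tensor_ker.
Proof.
split=> [|x y /asboolP xN /asboolP yN]; apply/asboolP => N NP.
  by case: NP => -[].
by have := NP => -[[_ NB] _]; apply: NB; [exact: xN|exact: yN].
Qed.
HB.instance Definition _ := GRing.isZmodClosed.Build F tensor_ker tensor_ker_zmod.

Lemma tensor_ker_rel z : tensor_rel z -> z \in (tensor_ker : pred F).
Proof. by move=> rz; apply/asboolP => N [_]; exact. Qed.

Definition tensor : Type := 
  Quotient.quot (GRing.ZmodClosed.clone F tensor_ker _).
HB.instance Definition _ := GRing.Zmodule.on tensor.
HB.instance Definition _ := Quotient.on tensor.

Definition tens (a : A) (m : M) : tensor := 
  \pi_tensor << (a, m) >>.

Lemma pi_tensorB (x y : F) :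
  x - y \in (tensor_ker : pred F) ->
  \pi_tensor x = \pi_tensor y.
Proof. by rewrite Quotient.idealrBE => /eqP. Qed.

Lemma pi_tensorD :
  {morph (\pi_tensor : F -> tensor) : x y / x + y}.
Proof. by move=> x y; rewrite Quotient.pi_add. Qed.

Lemma pi_tensorN : {morph (\pi_tensor : F -> tensor) : x / - x}.
Proof. exact: Quotient.pi_opp. Qed.

Lemma pi_tensor0 : \pi_tensor (0 : F) = 0 :> tensor.
Proof. by rewrite -(subrr (0 : F)) pi_tensorD pi_tensorN subrr. Qed.

Lemma tensDl m : {morph tens^~ m : a b / a + b}.
Proof.
move=> a b; rewrite /tens -pi_tensorD; apply: pi_tensorB.
by rewrite opprD addrA; apply/tensor_ker_rel; exact: tensor_rel_Dl.
Qed.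

Lemma tensDr a : {morph tens a : m n / m + n}.
Proof.
move=> m n; rewrite /tens -pi_tensorD; apply: pi_tensorB.
by rewrite opprD addrA; apply/tensor_ker_rel; exact: tensor_rel_Dr.
Qed.

Lemma tens_bal a s m : tens (actA a s) m = tens a (s *: m).
Proof. by apply: pi_tensorB; apply/tensor_ker_rel; exact: tensor_rel_bal. Qed.

Section Lift.
Variables (P : zmodType) (B : A -> M -> P).
Hypothesis BDl : forall m, {morph B^~ m : a b / a + b}.
Hypothesis BDr : forall a, {morph B a : m n / m + n}.
Hypothesis Bbal : forall a s m, B (actA a s) m = B a (s *: m).

Let flift (z : F) : P := fglift (fun p => B p.1 p.2 : zmodule P) z.

Let fliftB x y : flift (x - y) = flift x - flift y.
Proof. exact: (lift_is_additive (M := zmodule P)). Qed.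

Let flift1 p : flift << p >> = B p.1 p.2.
Proof. by rewrite /flift liftU scale1r. Qed.

Let flift_ker z : z \in (tensor_ker : pred F) -> flift z = 0.
Proof.
move=> /asboolP zK; apply: (zK [set x | flift x = 0]); split.
  split; first by have := fliftB 0 0; rewrite !subrr.
  by move=> x y x0 y0 /=; rewrite fliftB x0 y0 subrr.
move=> _ [a b m|a m n|a s m]; rewrite /= !fliftB !flift1 /=.
- by rewrite BDl -addrA -opprD subrr.
- by rewrite BDr -addrA -opprD subrr.
- by rewrite Bbal subrr.
Qed.

(* The additive map induced by a balanced biadditive map B. *)
Definition tensor_lift (t : tensor) : P :=
  fglift (fun p => B p.1 p.2 : zmodule P) (repr t).

Let tensor_lift_pi z : tensor_lift (\pi_tensor z) = flift z.
Proof.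
apply/eqP; rewrite -subr_eq0 -fliftB; apply/eqP/flift_ker.
by rewrite Quotient.idealrBE reprK.
Qed.

Lemma tensor_lift_tens a m : tensor_lift (tens a m) = B a m.
Proof. by rewrite tensor_lift_pi flift1. Qed.

Lemma tensor_lift_is_zmod_morphism : zmod_morphism tensor_lift.
Proof.
move=> x y; rewrite -[x]reprK -[y]reprK.
by rewrite -pi_tensorN -pi_tensorD !tensor_lift_pi fliftB.
Qed.

End Lift.

Lemma tensor_ind (Q : tensor -> Prop) :
  Q 0 -> (forall x y, Q x -> Q y -> Q (x - y)) -> (forall a m, Q (tens a m)) ->
  forall t, Q t.
Proof.
move=> Q0 QB Qt t.
have QN x : Q x -> Q (- x) by move=> Qx; rewrite -[- x]add0r; exact: QB.
have QD x y : Q x -> Q y -> Q (x + y).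
  by move=> Qx Qy; rewrite -[y]opprK; apply: QB => //; exact: QN.
have QMn x n : Q x -> Q (x *+ n).
  by move=> Qx; elim: n => [|n IHn]; rewrite ?mulr0n// mulrS; exact: QD.
have QMp (z : F) n : Q (\pi_tensor z) -> Q (\pi_tensor (z *+ n)).
  move=> /QMn-/(_ n); congr (Q _); elim: n => [|n IHn].
    by rewrite !mulr0n pi_tensor0.
  by rewrite !mulrS pi_tensorD IHn.
rewrite -[t]reprK -[repr t]freeg_sumE.
elim: (dom _) => [|p s IHs]; first by rewrite big_nil pi_tensor0.
rewrite big_cons pi_tensorD; apply: QD => //.
case: p => a m; rewrite -[coeff _ _]intz -freegU_mulz.
have Qam : Q (\pi_tensor << (a, m) >>) by exact: Qt.
case: (coeff _ _) => n; first exact: QMp.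
by rewrite NegzE mulrNz pi_tensorN; apply: QN; exact: QMp.
Qed.

End Tensor.

(* The product [gmul c e] is a total function, but it is only meaningful (and
   only constrained) when [gdom c = gran e]. *)
Record topGroupoid := TopGroupoid {
  obj : topologicalType;
  arr : topologicalType;
  gdom : arr -> obj;
  gran : arr -> obj;
  gid : obj -> arr;
  ginv : arr -> arr;
  gmul : arr -> arr -> arr;
  gdom_id : forall u, gdom (gid u) = u;
  gran_id : forall u, gran (gid u) = u;
  gdom_inv : forall c, gdom (ginv c) = gran c;
  gran_inv : forall c, gran (ginv c) = gdom c;
  gdom_mul : forall c e, gdom c = gran e -> gdom (gmul c e) = gdom e;
  gran_mul : forall c e, gdom c = gran e -> gran (gmul c e) = gran c;
  gmulA : forall a b c, gdom a = gran b -> gdom b = gran c ->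
    gmul a (gmul b c) = gmul (gmul a b) c;
  gmul_idr : forall c, gmul c (gid (gdom c)) = c;
  gmul_idl : forall c, gmul (gid (gran c)) c = c;
  gmulV : forall c, gmul c (ginv c) = gid (gran c);
  gVmul : forall c, gmul (ginv c) c = gid (gdom c);
  gdom_continuous : continuous gdom;
  gran_continuous : continuous gran;
  gid_continuous : continuous gid;
  ginv_continuous : continuous ginv;
  gmul_continuous : {within [set p : arr * arr | gdom p.1 = gran p.2],
    continuous (fun p => gmul p.1 p.2)}
}.

Lemma fsbig_morph (V W : nmodType) (L : V -> W) (T : choiceType) (D A : set T)
    (F : T -> V) :
  L 0 = 0 -> {morph L : x y / x + y} ->
  finite_set A -> (forall t, D t -> ~ A t -> F t = 0) ->
  L (\sum_(t \in D) F t) = \sum_(t \in D) L (F t).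
Proof.
move=> L0 LD finA AF; have finAD : finite_set (A `&` D) by exact: finite_setIl.
have rD : [set` fset_set (A `&` D)] `<=` D.
  by move=> t /=; rewrite in_fset_set// => /set_mem [].
have rF t : D t -> t \notin fset_set (A `&` D) -> F t = 0.
  move=> Dt; rewrite in_fset_set// => /negP nAt; apply: AF => // At.
  by apply: nAt; apply/mem_set.
rewrite (fsbigE (fset_set (A `&` D)))// (fsbigE (fset_set (A `&` D)))//.
  exact: (big_morph L LD L0).
by move=> t Dt /rF -> .
Qed.

Section Groupoid.
Variable G : topGroupoid.
Implicit Types (c e a b : arr G) (u : obj G).

Lemma gmulK c e : gdom c = gran e -> gmul (gmul c e) (ginv e) = c.
Proof. by move=> ce; rewrite -gmulA ?gran_inv// gmulV -ce gmul_idr. Qed.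

Lemma gmulVK c e : gdom c = gdom e -> gmul (gmul c (ginv e)) e = c.
Proof.
by move=> ce; rewrite -gmulA ?gran_inv ?gdom_inv// gVmul -ce gmul_idr.
Qed.

Lemma gmulKV c e : gdom c = gran e -> gmul (ginv c) (gmul c e) = e.
Proof. by move=> ce; rewrite gmulA ?gdom_inv// gVmul ce gmul_idl. Qed.

Lemma gmulVKV c e : gran c = gran e -> gmul c (gmul (ginv c) e) = e.
Proof. by move=> ce; rewrite gmulA ?gdom_inv ?gran_inv// gmulV ce gmul_idl. Qed.

Lemma ginvM c e : gdom c = gran e ->
  ginv (gmul c e) = gmul (ginv e) (ginv c).
Proof.
move=> ce; have ec : gdom (ginv e) = gran (ginv c) by rewrite gdom_inv gran_inv.
rewrite -[RHS](@gmulK _ (gmul c e)); last first.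
  by rewrite [in RHS]gran_mul// gdom_mul// gdom_inv.
rewrite -(gmulA ec) ?gran_mul ?gdom_inv// gmulKV// gVmul.
by rewrite -(gdom_mul ce) -gran_inv gmul_idl.
Qed.

Definition isotropy u : Type := {c : arr G | (gdom c == u) && (gran c == u)}.

Section Isotropy.
Variable u : obj G.
HB.instance Definition _ := Choice.on (isotropy u).

Lemma isotropy_dom (g : isotropy u) : gdom (val g) = u.
Proof. by case/andP: (valP g) => /eqP. Qed.
Lemma isotropy_ran (g : isotropy u) : gran (val g) = u.
Proof. by case/andP: (valP g) => _ /eqP. Qed.

Lemma isotropy_comp (g h : isotropy u) : gdom (val g) = gran (val h).
Proof. by rewrite isotropy_dom isotropy_ran. Qed.

Lemma isotropy1_subproof : (gdom (gid u) == u) && (gran (gid u) == u).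
Proof. by rewrite gdom_id gran_id eqxx. Qed.

Lemma isotropyV_subproof (g : isotropy u) :
  (gdom (ginv (val g)) == u) && (gran (ginv (val g)) == u).
Proof. by rewrite gdom_inv gran_inv isotropy_ran isotropy_dom eqxx. Qed.

Lemma isotropyM_subproof (g h : isotropy u) :
  (gdom (gmul (val g) (val h)) == u) && (gran (gmul (val g) (val h)) == u).
Proof.
have gh := isotropy_comp g h.
by rewrite gdom_mul// gran_mul// isotropy_ran isotropy_dom eqxx.
Qed.

Definition isotropy1 : isotropy u := exist _ (gid u) isotropy1_subproof.
Definition isotropyV g : isotropy u := 
  exist _ (ginv (val g)) (isotropyV_subproof g).
Definition isotropyM g h : isotropy u := 
  exist _ (gmul (val g) (val h)) (isotropyM_subproof g h).

Lemma isotropyMA : associative isotropyM.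
Proof. by move=> g h k; apply: val_inj; rewrite /= gmulA//; exact: isotropy_comp. Qed.

Lemma isotropyM1 : left_id isotropy1 isotropyM.
Proof. by move=> g; apply: val_inj; have := gmul_idl (val g); rewrite isotropy_ran. Qed.

Lemma isotropy1M : right_id isotropy1 isotropyM.
Proof. by move=> g; apply: val_inj; have := gmul_idr (val g); rewrite isotropy_dom. Qed.

Lemma isotropyVM : left_inverse isotropy1 isotropyV isotropyM.
Proof. by move=> g; apply: val_inj; rewrite /= gVmul isotropy_dom. Qed.

Lemma isotropyMV : right_inverse isotropy1 isotropyV isotropyM.
Proof. by move=> g; apply: val_inj; rewrite /= gmulV isotropy_ran. Qed.

HB.instance Definition _ := isGroup.Build (isotropy u)
  isotropyMA isotropyM1 isotropy1M isotropyVM isotropyMV.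

End Isotropy.

(* The set of the arrows with domain u. *)
Definition star u : Type := {c : arr G | gdom c == u}.
HB.instance Definition _ u := Choice.on (star u).
HB.instance Definition _ u := SubChoice.on (star u).

Lemma star_dom u (x : star u) : gdom (val x) = u.
Proof. exact/eqP/(valP x). Qed.

(* c times x; the default value x is returned if the product is undefined. *)
Definition star_lmul u c (x : star u) : star u := insubd x (gmul c (val x)).

Lemma star_lmulE u c (x : star u) :
  gdom c = gran (val x) -> val (star_lmul c x) = gmul c (val x).
Proof. by move=> cx; rewrite insubdK// unfold_in gdom_mul// star_dom. Qed.

Lemma star_rmul_subproof u (x : star u) (g : isotropy u) :
  gdom (gmul (val x) (val g)) == u.
Proof. by rewrite gdom_mul ?isotropy_dom// star_dom isotropy_ran. Qed.
Definition star_rmul u (x : star u) (g : isotropy u) : star u :=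
  exist _ (gmul (val x) (val g)) (star_rmul_subproof x g).

Lemma star_rmul_ran u (x : star u) g : gran (val (star_rmul x g)) = gran (val x).
Proof. by rewrite gran_mul// star_dom isotropy_ran. Qed.

Lemma star_lrmul u c (x : star u) g : gdom c = gran (val x) ->
  star_lmul c (star_rmul x g) = star_rmul (star_lmul c x) g.
Proof.
move=> cx; apply: val_inj; rewrite star_lmulE ?star_rmul_ran//= star_lmulE//.
by rewrite gmulA// star_dom isotropy_ran.
Qed.

Lemma star_rmulA u (x : star u) g h :
  star_rmul x (g * h)%g = star_rmul (star_rmul x g) h.
Proof.
apply: val_inj; rewrite /= gmulA//; last exact: isotropy_comp.
by rewrite star_dom isotropy_ran.
Qed.

Definition star_id u : star u := exist _ (gid u) (introT eqP (gdom_id u)).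

Section Convolution.
Variable R : comPzRingType.
Implicit Types f h : arr G -> R.

(* f * h evaluated at c is the sum of f a * h b over the pairs (a, b) such that
   a b is defined and equal to c. *)
Definition conv f h : arr G -> R := fun c =>
  \sum_(p \in [set p : arr G * arr G |
                gdom p.1 = gran p.2 /\ gmul p.1 p.2 = c]) f p.1 * h p.2.

(* The elements of the groupoid algebra have finite support on each fibre of
   gdom, which makes the sums in conv and lact finite. *)
Definition dfinite f := forall u, finite_set [set c | gdom c = u /\ f c != 0].

Lemma convE f h c :
  conv f h c = \sum_(b \in [set b | gdom b = gdom c])
                 f (gmul c (ginv b)) * h b.
Proof.
rewrite /conv (@reindex_fsbig _ _ _ _ _ (fun b => (gmul c (ginv b), b))
  [set b | gdom b = gdom c])//; split => /=.
- move=> b /= bc; rewrite gdom_mul ?gdom_inv ?gran_inv//; split => //.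
  by rewrite gmulVK.
- by move=> b b' _ _ [].
- move=> [a b] /= [ab <-]; exists b; rewrite ?gdom_mul//.
  by rewrite gmulK.
Qed.

Section Star.
Variable u : obj G.

(* f acting on the basis element x of the free module on the star of u: the
   sum of f c (c x) over the arrows c with gdom c = gran x. It is finite if f
   is d-finite. *)
Definition lact f (x : star u) : fmod R (star u) :=
  \sum_(c \in [set c | gdom c = gran (val x)]) f c *: fdelta (star_lmul c x).

Lemma lactE f x y : dfinite f ->
  lact f x y = f (gmul (val y) (ginv (val x))).
Proof.
move=> finf; rewrite /lact.
rewrite (@fsbig_morph _ _ (fun z : fmod R (star u) => z y) _ _ _ _ _ _
  (finf (gran (val x))))//; last first.
  move=> c /= cx /not_andP [//|/negP/negPn/eqP->]; exact: scale0r.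
have yx : gdom (val y) = gran (ginv (val x)) by rewrite gran_inv !star_dom.
rewrite -(@fsbig_widen _ _ _ _ [set gmul (val y) (ginv (val x))])/=.
- rewrite fsbig_set1 /= fmodZE fdeltaE.
  rewrite -val_eqE star_lmulE ?gmulVK ?eqxx ?mulr1 ?star_dom//.
  by rewrite gdom_mul ?gdom_inv.
- by move=> _ ->; rewrite /= gdom_mul ?gdom_inv.
- move=> c [/= cx nc]; rewrite fmodZE fdeltaE.
  case: eqP => [yE|]; last by rewrite mulr0.
  by case: nc; rewrite yE star_lmulE// gmulK.
Qed.

Lemma lact_sum f x (V : lmodType R) (L : {linear fmod R (star u) -> V}) :
  dfinite f ->
  L (lact f x) = \sum_(c \in [set c | gdom c = gran (val x)])
    f c *: L (fdelta (star_lmul c x)).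
Proof.
move=> finf; rewrite (@fsbig_morph _ _ _ _ _ _ _ _ _ (finf (gran (val x)))).
- by apply: eq_fsbigr => c _; rewrite linearZ.
- exact: linear0.
- exact: linearD.
- move=> c /= cx /not_andP [//|/negP/negPn/eqP->]; exact: scale0r.
Qed.

Definition sact f : fmod R (star u) -> fmod R (star u) := flin (lact f).

(* The right action of the group ring on the free module on the star of u. *)
Definition gract (z : fmod R (star u)) (s : gring R (isotropy u)) :
  fmod R (star u) := flin (fun x => flin (fun g => fdelta (star_rmul x g)) s) z.

Lemma sact_gract f z s : dfinite f -> sact f (gract z s) = gract (sact f z) s.
Proof.
move=> finf; rewrite /sact /gract !flin_comp; apply: eq_flin => x /=.
rewrite flin_comp.
rewrite flin_swap; apply: eq_flin => g /=.
rewrite flin_delta lact_sum// /lact star_rmul_ran.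
by apply: eq_fsbigr => c /set_mem cx; rewrite /= flin_delta star_lrmul.
Qed.

Lemma sact_gractM z (s t : gring R (isotropy u)) :
  gract (gract z s) t = gract z (s * t).
Proof.
rewrite /gract flin_comp; apply: eq_flin => x /=.
rewrite [in RHS]/GRing.mul /= /gring_mul !flin_comp; apply: eq_flin => g /=.
rewrite flin_delta flin_comp; apply: eq_flin => h /=.
by rewrite flin_delta star_rmulA.
Qed.

Lemma gractDl s : {morph gract^~ s : z z' / z + z'}.
Proof. by move=> z z'; rewrite /gract linearD. Qed.

Lemma gractDr z : {morph gract z : s t / s + t}.
Proof.
by move=> s t; rewrite /gract -flinD; apply: eq_flin => x; rewrite linearD.
Qed.

Lemma gractr1 z : gract z 1 = z.
Proof.
apply: (@fmod_ext _ _ _ (flin _) idfun) => x /=; rewrite !flin_delta.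
congr fdelta; apply: val_inj; have := gmul_idr (val x).
by rewrite star_dom.
Qed.

Lemma conv_dfinite f h : dfinite f -> dfinite h -> dfinite (conv f h).
Proof.
move=> finf finh v.
pose A := [set b | gdom b = v /\ h b != 0].
pose B b := (fun a => gmul a b) @` [set a | gdom a = gran b /\ f a != 0].
have : finite_set (\bigcup_(b in A) B b).
  apply: bigcup_finite => [|b _]; first exact: finh.
  by apply: finite_image; exact: finf.
apply: sub_finite_set => c /= [cv /eqP fhc]; apply: contrapT => nc.
apply: fhc; rewrite /conv fsbig1// => -[a b] /= [ab abc].
have [->|fa] := eqVneq (f a) 0; first by rewrite mul0r.
have [->|hb] := eqVneq (h b) 0; first by rewrite mulr0.
exfalso; apply: nc; exists b; first by split => //; rewrite -cv -abc gdom_mul.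
by exists a.
Qed.

Lemma lact_conv f h x : dfinite f -> dfinite h ->
  lact (conv f h) x = sact f (lact h x).
Proof.
move=> finf finh; apply: fmod_eq => y.
rewrite lactE; last exact: conv_dfinite.
rewrite /sact lact_sum//.
rewrite (@fsbig_morph _ _ (fun z : fmod R (star u) => z y) _ _ _ _ _ _
  (finh (gran (val x))))//; last first.
  move=> c /= cx /not_andP [//|/negP/negPn/eqP->]; exact: scale0r.
have yx : gdom (val y) = gran (ginv (val x)) by rewrite gran_inv !star_dom.
rewrite convE gdom_mul// gdom_inv; apply: eq_fsbigr => c /set_mem /= cx.
rewrite fmodZE flin_delta lactE// star_lmulE// mulrC; congr (_ * f _).
by rewrite ginvM// gmulA// ?gdom_inv ?gran_inv.
Qed.

Lemma sact_conv f h z : dfinite f -> dfinite h ->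
  sact (conv f h) z = sact f (sact h z).
Proof.
move=> finf finh; rewrite [in RHS]/sact flin_comp; apply: eq_flin => x.
exact: lact_conv.
Qed.

Lemma lactD f h x : dfinite f -> dfinite h -> dfinite (f \+ h) ->
  lact (f \+ h) x = lact f x + lact h x.
Proof. by move=> *; apply: fmod_eq => y; rewrite fmodDE !lactE. Qed.

Lemma sactD f h z : dfinite f -> dfinite h -> dfinite (f \+ h) ->
  sact (f \+ h) z = sact f z + sact h z.
Proof.
by move=> *; rewrite -flinD; apply: eq_flin => x; rewrite lactD.
Qed.

Lemma sactDr f : {morph sact f : z z' / z + z'}.
Proof. by move=> z z'; rewrite /sact linearD. Qed.

(* A d-finite function is determined by its action on the identity at u. *)
Lemma lact_id f (y : star u) : dfinite f -> lact f (star_id u) y = f (val y).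
Proof.
move=> finf; rewrite lactE//=; congr f.
have yu : gdom (val y) = gran (gid u) by rewrite star_dom gran_id.
have := gmulK yu; have := gmul_idr (val y); rewrite star_dom => -> //.
Qed.

End Star.

Lemma conv_lact f h c : dfinite f -> dfinite h ->
  let c' : star (gdom c) := exist _ c (eqxx (gdom c)) in
  conv f h c = sact f (lact h (star_id (gdom c))) c'.
Proof.
move=> finf finh c'; rewrite -lact_conv// lact_id//; exact: conv_dfinite.
Qed.

Lemma convA f h k : dfinite f -> dfinite h -> dfinite k ->
  conv f (conv h k) = conv (conv f h) k.
Proof.
move=> finf finh fink; apply/funext => c.
have finfh := conv_dfinite finf finh; have finhk := conv_dfinite finh fink.
by rewrite !conv_lact// sact_conv// lact_conv.
Qed.

Lemma convDl f h k : dfinite f -> dfinite h -> dfinite (f \+ h) -> dfinite k ->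
  conv (f \+ h) k = conv f k \+ conv h k.
Proof.
by move=> *; apply/funext => c /=; rewrite !conv_lact// sactD.
Qed.

Lemma convDr f h k : dfinite f -> dfinite h -> dfinite (f \+ h) -> dfinite k ->
  conv k (f \+ h) = conv k f \+ conv k h.
Proof.
by move=> *; apply/funext => c /=; rewrite !conv_lact// lactD// sactDr.
Qed.

End Convolution.
End Groupoid.

Definition local_homeomorphism (X Y : topologicalType) (f : X -> Y) : Prop :=
  forall x, exists U : set X, [/\ open U, U x, open (f @` U) &
    exists g : Y -> X, [/\ {within U, continuous f},
      {within f @` U, continuous g} & {in U, cancel f g}]].

(* Compactness including the Hausdorff axiom for the subspace topology. *)
Definition hcompact (X : topologicalType) (U : set X) : Prop :=
  compact U /\ hausdorff_space (set_type U).

Definition etale (G : topGroupoid) : Prop := local_homeomorphism (@gdom G).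

Definition ample (G : topGroupoid) : Prop :=
  [/\ etale G, locally_compact [set: obj G], hausdorff_space (obj G) &
      exists2 B : set (set (obj G)), basis B &
        forall U, B U -> open U /\ hcompact U].

Record ampleGroupoid :=
  AmpleGroupoid { ample_groupoid :> topGroupoid; ampleP : ample ample_groupoid }.

Section TopologyFacts.

Lemma set_type_hausdorffP (X : topologicalType) (U : set X) :
  hausdorff_space (set_type U) <->
  forall x y, U x -> U y ->
    (forall A B, nbhs x A -> nbhs y B -> exists z, [/\ U z, A z & B z]) -> x = y.
Proof.
have cval : continuous (set_val : set_type U -> X) by exact: initial_continuous.
split => [hU x y Ux Uy xy|hU p q pq].
  suff : SigSub (mem_set Ux) = SigSub (mem_set Uy) :> U by move=> /(congr1 set_val).
  apply: hU => A B [_ [[A' oA' <-] /= A'x AA']] [_ [[B' oB' <-] /= B'y BB']].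
  have [z [Uz A'z B'z]] := xy A' B' (open_nbhs_nbhs (conj oA' A'x))
    (open_nbhs_nbhs (conj oB' B'y)).
  by exists (SigSub (mem_set Uz)); split; [exact: AA'|exact: BB'].
apply: val_inj; apply: hU; [exact/set_mem/(valP p)|exact/set_mem/(valP q)|].
move=> A B pA qB; have [z [Az Bz]] := pq _ _ (cval _ _ pA) (cval _ _ qB).
by exists (val z); split => //; exact/set_mem/(valP z).
Qed.

Lemma hausdorff_inj (X Y : topologicalType) (f : X -> Y) (U : set X) :
  hausdorff_space Y -> continuous f -> {in U &, injective f} ->
  hausdorff_space (set_type U).
Proof.
move=> hY cf fI; apply/set_type_hausdorffP => x y Ux Uy xy.
apply: fI; [exact/mem_set|exact/mem_set|].
apply: hY => A B fA fB.
have [z [_ Az Bz]] := xy _ _ (cf _ _ fA) (cf _ _ fB).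
by exists (f z).
Qed.

Lemma hcompact_openD (X : topologicalType) (U A : set X) :
  open U -> hausdorff_space (set_type U) -> compact A -> A `<=` U ->
  open (U `\` A).
Proof.
move=> oU hU cA AU; rewrite openE => x [Ux nAx].
rewrite /interior/=; apply: contrapT => nUA.
have PF : ProperFilter (within A (nbhs x)).
  apply: Build_ProperFilter_ex => P PA; apply: contrapT => nP; apply: nUA.
  have Uxn : nbhs x U by exact: open_nbhs_nbhs.
  have PA' : nbhs x [set z | A z -> P z] := PA.
  apply: filterS (filterI Uxn PA') => z [Uz Pz]; split => //.
  by move=> Az; apply: nP; exists z; exact: Pz.
have [a [Aa xa]] := cA _ PF (withinT _ _).
apply: nAx; suff -> : x = a by [].
apply: (proj1 (set_type_hausdorffP U) hU) => //; first exact: AU.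
move=> P Q xP aQ; have [z [[Pz Az] Qz]] : (P `&` A) `&` Q !=set0.
  apply: xa => //; rewrite /within /=; near=> z => Az; split => //.
  near: z; exact: xP.
by exists z; split => //; exact: AU.
Unshelve. all: by end_near.
Qed.

(* A finite subcover principle, free of any pointedness assumption. *)
Lemma compact_seq_cover (X : topologicalType) (U : set X) (P : set (set X)) :
  compact U -> (forall x, U x -> exists2 B, P B & nbhs x B) ->
  exists2 s : seq (set X), [set` s] `<=` P & U `<=` \bigcup_(B in [set` s]) B.
Proof.
move=> cU xP; apply: contrapT => nocov.
pose F : set_system X := [set A | exists2 s : seq (set X), [set` s] `<=` P &
  U `\` \bigcup_(B in [set` s]) B `<=` A].
have PF : ProperFilter F.
  split.
    move=> [s Ps sU]; apply: nocov; exists s => // x Ux.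
    by apply: contrapT => nx; exact: (sU x).
  split.
  - by exists [::].
  - move=> A B [s Ps sA] [t Pt tB]; exists (s ++ t).
      by move=> V /=; rewrite mem_cat => /orP[/Ps|/Pt].
    move=> x [Ux nx]; split.
      apply: sA; split => // -[V /= Vs Vx]; apply: nx; exists V => //=.
      by rewrite mem_cat Vs.
    apply: tB; split => // -[V /= Vs Vx]; apply: nx; exists V => //=.
    by rewrite mem_cat Vs orbT.
  - by move=> A B AB [s Ps sA]; exists s => //; exact: subset_trans AB.
have FU : F U by exists [::] => // x [].
have [x [Ux xF]] := cU F PF FU.
have [B PB xB] := xP x Ux.
have [|z [nBz Bz]] := xF (~` B) B _ xB; last exact: nBz.
exists [:: B]; first by move=> V /=; rewrite inE => /eqP ->.
by move=> z /= [_ nz] Bz; apply: nz; exists B => //=; rewrite inE.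
Qed.

End TopologyFacts.

Section Ample.
Variable G : ampleGroupoid.

Let etaleG : etale G. Proof. by case: (ampleP G). Qed.
Let hausG : hausdorff_space (obj G). Proof. by case: (ampleP G). Qed.

Lemma ginvK : involutive (@ginv G).
Proof.
move=> c; have cc : gdom c = gran (ginv c) by rewrite gran_inv.
have := @gmulKV _ (ginv c) c; rewrite gdom_inv => /(_ erefl).
by rewrite gVmul -gran_inv -[gran (ginv c)]gdom_inv gmul_idr.
Qed.

Definition bisection (B : set (arr G)) : Prop :=
  [/\ open B, compact B, {in B &, injective (@gdom G)} &
      {in B &, injective (@gran G)}].

Lemma bisection_hcompact B : bisection B -> open B /\ hcompact B.
Proof.
move=> [oB cB dB _]; split => //; split => //.
by apply: hausdorff_inj dB => //; exact: gdom_continuous.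
Qed.

Lemma gdom_nbhs (c : arr G) (W : set (arr G)) :
  nbhs c W -> nbhs (gdom c) (@gdom G @` W).
Proof.
move=> cW; have [U [oU Uc odU [g [_ cg gK]]]] := etaleG c.
have dUc : nbhs (gdom c) (@gdom G @` U).
  by apply: open_nbhs_nbhs; split => //; exists c.
have cgc : {for gdom c, continuous g}.
  move: cg; rewrite continuous_open_subspace// => /(_ (gdom c)); apply.
  by apply/mem_set; exists c.
have gW : nbhs (gdom c) (g @^-1` W) by apply: cgc; rewrite gK ?inE.
apply: filterS (filterI dUc gW) => _ [[e Ue <-]] /=; rewrite gK ?inE// => We.
by exists e.
Qed.

Lemma gdom_open (W : set (arr G)) : open W -> open (@gdom G @` W).
Proof.
move=> oW; rewrite openE => _ [c Wc <-]; apply: gdom_nbhs.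
exact: open_nbhs_nbhs.
Qed.

Lemma bisection_nbhs (c : arr G) (W : set (arr G)) : open W -> W c ->
  exists B, [/\ bisection B, B c & B `<=` W].
Proof.
move=> oW Wc; have [U [oU Uc odU [g [_ cg gK]]]] := etaleG c.
have [U' [oU' U'c _ [g' [_ _ g'K]]]] := etaleG (ginv c).
pose V := @ginv G @^-1` U'.
have oV : open V.
  by apply: open_comp => // x _; exact: ginv_continuous.
pose W' := W `&` U `&` V.
have oW' : open W' by apply: openI => //; exact: openI.
have W'c : W' c by [].
have [_ _ _ [BB [_ bB] BBh]] := ampleP G.
have [K [BK Kc] KW'] := bB (gdom c) _ (gdom_nbhs (open_nbhs_nbhs (conj oW' W'c))).
have [oK [cK _]] := BBh K BK.
have gW' x : K x -> W' (g x) /\ gdom (g x) = x.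
  by move=> /KW' [e W'e <-]; rewrite gK ?inE//; case: W'e => -[].
have BE : g @` K = W' `&` @gdom G @^-1` K.
  apply/seteqP; split => [_ [x Kx <-]|e [W'e Ke]].
    by have [? gx] := gW' x Kx; split => //=; rewrite gx.
  by exists (gdom e) => //; rewrite gK ?inE//; case: W'e => -[].
have BI e : (g @` K) e -> U e /\ V e by rewrite BE => -[[[]]].
exists (g @` K); split; last 2 first.
- by rewrite BE.
- by rewrite BE => e [[[]]].
split.
- rewrite BE; apply: openI => //; apply: open_comp => // x _.
  exact: gdom_continuous.
- apply: continuous_compact => //; apply: continuous_subspaceW cg.
  by move=> x /gW' [[[_ Ux] _] <-]; exists (g x).
- move=> a b /set_mem/BI[Ua _] /set_mem/BI[Ub _] ab.
  by rewrite -[a]gK ?inE// ab gK ?inE.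
- move=> a b /set_mem/BI[_ Va] /set_mem/BI[_ Vb] ab.
  rewrite -[a]ginvK -[b]ginvK; congr ginv.
  by rewrite -[ginv a]g'K ?inE// gdom_inv ab -gdom_inv g'K ?inE.
Qed.

Definition bisection_mul (B C : set (arr G)) : set (arr G) :=
  (fun p => gmul p.1 p.2) @`
    ((B `*` C) `&` [set p : arr G * arr G | gdom p.1 = gran p.2]).

Lemma composable_closed : closed [set p : arr G * arr G | gdom p.1 = gran p.2].
Proof.
move=> p pcl; apply: hausG => P Q pP pQ.
have pP' : nbhs p ((fun q : arr G * arr G => gdom q.1) @^-1` P).
  apply: (continuous_comp (f := fst) (g := @gdom G)) pP; first exact: cvg_fst.
  exact: gdom_continuous.
have pQ' : nbhs p ((fun q : arr G * arr G => gran q.2) @^-1` Q).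
  apply: (continuous_comp (f := snd) (g := @gran G)) pQ; first exact: cvg_snd.
  exact: gran_continuous.
have [q [/= qq [Pq Qq]]] := pcl _ (filterI pP' pQ').
by exists (gdom q.1); split => //; rewrite qq.
Qed.

Lemma bisection_mulP B C : bisection B -> bisection C ->
  bisection (bisection_mul B C).
Proof.
move=> [oB cB dB rB] [oC cC dC rC]; split.
- rewrite openE => _ [[b c] [[/= Bb Cc] bc] <-].
  have [U [oU Uc odU [g [_ cg gK]]]] := etaleG c.
  set x := gmul b c; have xc : gdom x = gdom c by rewrite gdom_mul.
  have cgx : {for gdom x, continuous g}.
    move: cg; rewrite continuous_open_subspace// => /(_ (gdom x)); apply.
    by apply/mem_set; exists c.
  have cs : {for x, continuous (fun y : arr G => g (gdom y))}.
    exact: (continuous_comp (gdom_continuous (x:=x))).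
  have csi : {for x, continuous (fun y : arr G => ginv (g (gdom y)))}.
    exact: (continuous_comp cs (ginv_continuous (x:=_))).
  have gx : g (gdom x) = c by rewrite xc gK ?inE.
  have nU : nbhs x [set y | (@gdom G @` U) (gdom y)].
    apply: gdom_continuous; apply: open_nbhs_nbhs; split => //.
    by exists c.
  have nC : nbhs x [set y | C (g (gdom y))].
    by apply: cs; rewrite gx; exact: open_nbhs_nbhs.
  have cp : (fun y : arr G => (y, ginv (g (gdom y)))) y @[y --> x] -->
      (x, ginv (g (gdom x))) by apply: cvg_pair => //; exact: cvg_id.
  have mB : nbhs (x, ginv c) [set q : arr G * arr G |
      gdom q.1 = gran q.2 -> B (gmul q.1 q.2)].
    have := (proj1 (subspace_continuousP _ _) (@gmul_continuous G)).
    move=> /(_ (x, ginv c)); rewrite /= gran_inv => /(_ xc); apply.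
    apply: open_nbhs_nbhs; split => //.
    by rewrite /from_subspace /= gmulK.
  have nB : nbhs x [set y | gdom y = gran (ginv (g (gdom y))) ->
      B (gmul y (ginv (g (gdom y))))].
    by move: cp; rewrite gx => cp; exact: (cp _ mB).
  near=> y.
  have [e Ue ey] : (@gdom G @` U) (gdom y) by near: y; exact: nU.
  have gy : g (gdom y) = e by rewrite -ey gK ?inE.
  exists (gmul y (ginv (g (gdom y))), g (gdom y)) => /=; last first.
    by rewrite gmulVK// gy.
  split; [split => /=|].
  + have : gdom y = gran (ginv (g (gdom y))) by rewrite gran_inv gy.
    by near: y; exact: nB.
  + by near: y; exact: nC.
  + by rewrite /= gdom_mul ?gdom_inv// gran_inv gy.
- apply: continuous_compact.
    by apply: continuous_subspaceW (@gmul_continuous G) => p [].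
  apply: compact_closedI; first exact: compact_setX.
  exact: composable_closed.
- move=> x y /set_mem [[b c] /= [[/= Bb Cc] bc] <-].
  move=> /set_mem [[b' c'] /= [[/= Bb' Cc'] bc'] <-].
  rewrite !gdom_mul// => /(dC _ _ (mem_set Cc) (mem_set Cc')) cc'.
  congr gmul => //; apply: dB; rewrite ?inE//.
  by rewrite bc bc' cc'.
- move=> x y /set_mem [[b c] /= [[/= Bb Cc] bc] <-].
  move=> /set_mem [[b' c'] /= [[/= Bb' Cc'] bc'] <-].
  rewrite !gran_mul// => /(rB _ _ (mem_set Bb) (mem_set Bb')) bb'.
  congr gmul => //; apply: rC; rewrite ?inE//.
  by rewrite -bc -bc' bb'.
Unshelve. all: by end_near.
Qed.

Lemma bisectionD B A : bisection B -> open A -> open (B `\` A) ->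
  bisection (B `\` A).
Proof.
move=> [oB cB dB rB] oA oBA; split => //.
- apply: compact_closedI => //; exact: open_closedC.
- by move=> x y /set_mem [Bx _] /set_mem [By _]; apply: dB; rewrite inE.
- by move=> x y /set_mem [Bx _] /set_mem [By _]; apply: rB; rewrite inE.
Qed.

End Ample.

Section GroupoidAlgebra.
Variables (R : comPzRingType) (G : ampleGroupoid).
Implicit Types f h : arr G -> R^o.

(* The span of the characteristic functions of the compact (hence Hausdorff)
   open subsets; arr G itself need not be Hausdorff. *)
Definition galg_span f : bool :=
  `[< exists n (a : 'I_n -> R) (U : 'I_n -> set (arr G)),
        (forall i, open (U i) /\ hcompact (U i)) /\
        f = \sum_(i < n) a i *: (\1_(U i) : arr G -> R^o) >].

(* The span of the characteristic functions of the compact open bisections is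
   the same (galg_spanP). *)
Inductive bspan : (arr G -> R^o) -> Prop :=
| bspan0 : bspan 0
| bspanD a B f : bisection B -> bspan f ->
    bspan (a *: (\1_B : arr G -> R^o) + f).

Lemma bspan_add f h : bspan f -> bspan h -> bspan (f + h).
Proof.
elim=> [|a B k bB _ IH] bh; first by rewrite add0r.
by rewrite -addrA; apply: bspanD => //; exact: IH.
Qed.

Lemma bspan_scale a f : bspan f -> bspan (a *: f).
Proof.
elim=> [|b B k bB _ IH]; first by rewrite scaler0; exact: bspan0.
by rewrite scalerDr scalerA; exact: bspanD.
Qed.

Lemma bspan_indic B : bisection B -> bspan (\1_B : arr G -> R^o).
Proof.
move=> bB; rewrite -[X in bspan X]scale1r -[X in bspan X]addr0.
by apply: bspanD => //; exact: bspan0.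
Qed.

Lemma indicD (A B : set (arr G)) :
  (\1_(B `|` A) : arr G -> R^o) = \1_A + \1_(B `\` A).
Proof.
apply/funext => c; rewrite -[RHS]/(\1_A c + \1_(B `\` A) c : R) !indicE.
by rewrite in_setU in_setD; case: (c \in A); case: (c \in B);
  rewrite /= ?addr0 ?add0r.
Qed.

Lemma bspan_hcompact U : open U -> hcompact U -> bspan (\1_U : arr G -> R^o).
Proof.
move=> oU [cU hU].
have [|s sB sU] := @compact_seq_cover _ U [set B | bisection B /\ B `<=` U] cU.
  move=> x Ux; have [B [bB Bx BU]] := bisection_nbhs oU Ux.
  by exists B => //; apply: open_nbhs_nbhs; split => //; case: bB.
have -> : U = \bigcup_(B in [set` s]) B.
  by apply/seteqP; split => // x [B /sB[_ BU] /BU].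
suff: [/\ open (\bigcup_(B in [set` s]) B), compact (\bigcup_(B in [set` s]) B),
    \bigcup_(B in [set` s]) B `<=` U &
    bspan (\1_(\bigcup_(B in [set` s]) B) : arr G -> R^o)] by case.
elim: s sB {sU} => [|B s IHs] sB.
  rewrite (_ : \bigcup_(B in _) B = set0); last first.
    by rewrite -subset0 => x [].
  split=> //; [exact: open0|exact: compact0|].
  by rewrite indic0; exact: bspan0.
have [|oA cA AU bA] := IHs.
  by move=> C /= Cs; apply: sB; rewrite /= inE Cs orbT.
have [bB BU] : bisection B /\ B `<=` U by apply: sB; rewrite /= inE eqxx.
set A := \bigcup_(B in [set` s]) B in oA cA AU bA *.
have -> : \bigcup_(C in [set` B :: s]) C = B `|` A.
  apply/seteqP; split => x.
    move=> [C /=]; rewrite inE => /orP[/eqP-> Bx|Cs Cx]; first by left.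
    by right; exists C.
  move=> [Bx|[C /= Cs Cx]]; first by exists B => //=; rewrite inE eqxx.
  by exists C => //=; rewrite inE Cs orbT.
have [oB cB _ _] := bB.
split; [exact: openU|exact: compactU|by rewrite subUset|].
rewrite indicD; apply: bspan_add => //; apply/bspan_indic/bisectionD => //.
rewrite (_ : B `\` A = B `&` (U `\` A)); first by apply: openI => //; exact: hcompact_openD.
by rewrite setIDA (setIidl BU).
Qed.

Lemma galg_spanP f : galg_span f <-> bspan f.
Proof.
split.
  move=> /asboolP [n [a [U [hU ->]]]].
  elim/big_ind : _ => [|f1 f2|i _]; [exact: bspan0|exact: bspan_add|].
  by apply: bspan_scale; have [? ?] := hU i; exact: bspan_hcompact.
elim=> [|a B k bB _ /asboolP [n [b [U [hU ->]]]]]; apply/asboolP.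
  exists 0%N, (fun=> 0), (fun=> set0); split; first by case.
  by rewrite big_ord0.
exists n.+1, (fun i => if unlift ord0 i is Some j then b j else a),
  (fun i => if unlift ord0 i is Some j then U j else B); split => [i|].
  case: unliftP => [j _|_]; [exact: hU|exact: bisection_hcompact].
rewrite big_ord_recl unlift_none; congr (_ + _).
by apply: eq_bigr => i _; rewrite liftK.
Qed.

Lemma galg_span_submod : subsemimod_closed galg_span.
Proof.
split; first split.
- by apply/galg_spanP; exact: bspan0.
- by move=> f h /galg_spanP ? /galg_spanP ?; apply/galg_spanP; exact: bspan_add.
- by move=> a f /galg_spanP ?; apply/galg_spanP; exact: bspan_scale.
Qed.

HB.instance Definition _ :=
  GRing.isSubmodClosed.Build R (arr G -> R^o) galg_span galg_span_submod.

Record galg := Galg { galg_fun : arr G -> R^o; _ : galg_span galg_fun }.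

HB.instance Definition _ := [isSub for galg_fun].
HB.instance Definition _ := [Choice of galg by <:].
HB.instance Definition _ := [SubChoice_isSubLmodule of galg by <:].

Definition gcoef (x : galg) : arr G -> R := galg_fun x.
Coercion gcoef : galg >-> Funclass.

Lemma dfiniteD (f h : arr G -> R) : dfinite f -> dfinite h -> dfinite (f \+ h).
Proof.
move=> finf finh u.
have : finite_set ([set c | gdom c = u /\ f c != 0] `|`
                   [set c | gdom c = u /\ h c != 0]).
  by rewrite finite_setU; split; [exact: finf|exact: finh].
apply: sub_finite_set => c /= [cu].
have [->|f0 _] := eqVneq (f c) 0; last by left.
by rewrite add0r => h0; right.
Qed.

Lemma dfinite_bisection a B : bisection B ->
  dfinite (a *: (\1_B : arr G -> R^o) : arr G -> R).
Proof.
move=> [_ _ dB _] u; pose c0 := xget (gid u) [set c | gdom c = u /\ B c].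
apply: (@sub_finite_set _ _ [set c0]) => // c /= [cu].
rewrite -[(_ *: _) c]/(a * \1_B c) indicE.
have [/set_mem Bc _|_] := boolP (c \in B); last by rewrite mulr0 eqxx.
rewrite /c0; case: xgetP => [c' -> [c'u Bc']|/(_ c) []] //.
by apply: dB; rewrite ?inE// c'u.
Qed.

Lemma dfinite_bspan f : bspan f -> dfinite (f : arr G -> R).
Proof.
elim=> [u|a B k bB _ IH]; last exact: dfiniteD (dfinite_bisection a bB) IH.
rewrite (_ : [set _ | _] = set0)//.
by rewrite -subset0 => c /= [_]; rewrite eqxx.
Qed.

Lemma galg_dfinite (x : galg) : dfinite x.
Proof. by apply/dfinite_bspan/galg_spanP/(valP x). Qed.

Lemma conv_bisection a b B C : bisection B -> bisection C ->
  conv (a *: (\1_B : arr G -> R^o) : arr G -> R) (b *: (\1_C : arr G -> R^o))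
  = (a * b) *: (\1_(bisection_mul B C) : arr G -> R^o).
Proof.
move=> [_ _ dB _] [_ _ dC _]; apply/funext => c.
rewrite -[RHS]/(a * b * \1_(bisection_mul B C) c) indicE /conv.
have E p : (a *: (\1_B : arr G -> R^o)) p.1 * (b *: (\1_C : arr G -> R^o)) p.2 =
    a * b * ((p.1 \in B) && (p.2 \in C))%:R :> R.
  rewrite -[LHS]/((a * \1_B p.1) * (b * \1_C p.2)) !indicE mulrACA.
  by rewrite -natrM mulnb.
under eq_fsbigr => p _ do rewrite E.
have [/set_mem [[b1 c1] /= [[/= Bb1 Cc1] bc] bcc]|nc] :=
    boolP (c \in bisection_mul B C).
  rewrite -(@fsbig_widen _ _ _ _ [set (b1, c1)]) /=.
  - by rewrite fsbig_set1 /= !mem_set.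
  - by move=> _ -> /=.
  - move=> [b2 c2] /= [[bc2 bcc2] n2].
    have [/andP[/set_mem Bb2 /set_mem Cc2]|] := boolP (_ && _);
      last by rewrite mulr0.
    case: n2; have cc : c2 = c1.
      apply: dC; rewrite ?inE//.
      by rewrite -(gdom_mul bc2) bcc2 -bcc gdom_mul.
    by congr (_, _) => //; apply: dB; rewrite ?inE// bc bc2 cc.
rewrite mulr0 fsbig1// => -[b2 c2] /= [bc2 bcc2].
have [/andP[/set_mem Bb2 /set_mem Cc2]|] := boolP (_ && _); last by rewrite mulr0.
by move: nc; rewrite mem_set//; exists (b2, c2).
Qed.

Lemma conv_bspan f h : bspan f -> bspan h -> bspan (conv (f : arr G -> R) h).
Proof.
move=> bf bh; elim: bf => [|a B k bB bk IH].
  rewrite (_ : conv _ _ = 0); first exact: bspan0.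
  by apply/funext => c; rewrite /conv fsbig1// => p _; rewrite mul0r.
have fB := dfinite_bisection a bB; have fk := dfinite_bspan bk.
rewrite (convDl fB fk (dfiniteD fB fk) (dfinite_bspan bh)).
apply: bspan_add => //; elim: bh {IH} => [|b C l bC bl IH].
  rewrite (_ : conv _ _ = 0); first exact: bspan0.
  by apply/funext => c; rewrite /conv fsbig1// => p _; rewrite mulr0.
have fC := dfinite_bisection b bC; have fl := dfinite_bspan bl.
rewrite (convDr fC fl (dfiniteD fC fl) fB); apply: bspan_add => //.
rewrite conv_bisection//; apply/bspan_scale/bspan_indic.
exact: bisection_mulP.
Qed.

Lemma galg_mul_subproof (x y : galg) :
  galg_span (conv x y).
Proof.
by apply/galg_spanP/conv_bspan; apply/galg_spanP; [exact: (valP x)|exact: (valP y)].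
Qed.

Definition galg_mul (x y : galg) : galg := Galg (galg_mul_subproof x y).

Lemma galg_mulA : associative galg_mul.
Proof.
move=> x y z; apply/val_inj; apply: (@convA G R); exact: galg_dfinite.
Qed.

Lemma galg_mulDl : left_distributive galg_mul +%R.
Proof.
move=> x y z; apply/val_inj; apply: (@convDl G R); try exact: galg_dfinite.
exact: (@galg_dfinite (x + y)).
Qed.

Lemma galg_mulDr : right_distributive galg_mul +%R.
Proof.
move=> x y z; apply/val_inj; apply: (@convDr G R); try exact: galg_dfinite.
exact: (@galg_dfinite (y + z)).
Qed.

HB.instance Definition _ :=
  Zmodule_isRng.Build galg galg_mulA galg_mulDl galg_mulDr.

Section Induction.
Variables (u : obj G) (M : lmodType (gring R (isotropy u))).

(* R[star u] tensored with M over the group ring of the isotropy group at u. *)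
Definition induced : Type := tensor (@gract G R u) M.
HB.instance Definition _ := GRing.Zmodule.on induced.

Definition ind_act (x : galg) : induced -> induced :=
  tensor_lift (fun z m => tens (@gract G R u) (sact x z) m).

Lemma ind_actB x : zmod_morphism (ind_act x).
Proof.
apply: tensor_lift_is_zmod_morphism.
- by move=> m z z' /=; rewrite sactDr tensDl.
- by move=> z m n /=; rewrite tensDr.
- by move=> z s m ; rewrite (sact_gract _ _ (galg_dfinite x)); exact: tens_bal.
Qed.

(* x (z ⊗ m) = (x z) ⊗ m *)
Lemma ind_act_tens x z m :
  ind_act x (tens (@gract G R u) z m) =
  tens (@gract G R u) (sact x z) m.
Proof.
apply: tensor_lift_tens.
- by move=> {}m z1 z' /=; rewrite sactDr tensDl.
- by move=> z1 m1 n /=; rewrite tensDr.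
- by move=> z1 s m1 ; rewrite (sact_gract _ _ (galg_dfinite x)); exact: tens_bal.
Qed.

Lemma ind_act0 x : ind_act x 0 = 0.
Proof. by have := ind_actB x 0 0; rewrite !subrr. Qed.

Lemma ind_actDr x : {morph ind_act x : s t / s + t}.
Proof.
move=> s t; have tN : ind_act x (- t) = - ind_act x t.
  by rewrite -[- t]add0r ind_actB ind_act0 add0r.
by rewrite -[in LHS](opprK t) ind_actB tN opprK.
Qed.

Lemma ind_actA x y t : ind_act (rmul x y) t = ind_act x (ind_act y t).
Proof.
elim/tensor_ind : t => [|s t IHs IHt|z m]; first by rewrite !ind_act0.
  by rewrite !ind_actB IHs IHt.
by rewrite !ind_act_tens /= sact_conv//; exact: galg_dfinite.
Qed.

Lemma ind_actDl t : {morph ind_act^~ t : x y / x + y}.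
Proof.
move=> x y; elim/tensor_ind : t => [|s t IHs IHt|z m].
- by rewrite !ind_act0 addr0.
- by rewrite !ind_actB IHs IHt opprD addrACA.
- rewrite !ind_act_tens -tensDl; congr tens.
  apply: sactD; try exact: galg_dfinite.
  exact: (@galg_dfinite (x + y)).
Qed.

HB.instance Definition _ :=
  Zmodule_isRngModule.Build galg induced ind_actA ind_actDl ind_actDr.

End Induction.
End GroupoidAlgebra.

(* Main.v *)
From mathcomp Require Import fingroup cyclic pgroup.
Require Import Defs.
From HB Require Import structures.
From mathcomp Require Import all_boot all_order all_algebra finmap all_classical.
From mathcomp Require Import topology numfun freeg.
Import GRing.Theory.
Local Open Scope classical_set_scope.
Local Open Scope ring_scope.

Set Implicit Arguments.
Unset Strict Implicit.
Unset Printing Implicit Defensive.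

(* Let M be a simple module over the groupoid algebra. Its stalk at a unit u is
   the quotient of M by the elements killed by 1_K for some compact open
   neighbourhood K of u; it is a module over the group ring of the isotropy group
   at u, and some stalk is nonzero. If W is a simple quotient of that stalk, then
   M and Ind_u(W) have the same annihilator: conjugating f by bisections expresses
   its action on Ind_u(W) through its action on M, and if f m <> 0 then some
   h f m has nonzero image in W, so that h f does not kill Ind_u(W).

   Simple quotients exist because, under the hypotheses, every nonzero module over
   the group ring has a maximal submodule: an element x of R generating a minimal
   ideal not annihilating the module V gives a nonzero quotient x V over a field.
   If the group is finite, intersecting the translates of a hyperplane gives a
   nonzero quotient of finite dimension. If it is locally finite, abelian and of
   invertible orders, Maschke's theorem on finite subgroups shows that a submodule
   maximal among those avoiding a vector is maximal.

   Conversely Ind_u(W) is simple when W is. *)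

(** * Maximal submodules over group rings *)

Section Submodules.
Variables (S M : zmodType) (act : S -> M -> M).
Implicit Types (L N Q : set M) (F C : set (set M)).

Lemma submoduleN N m : submodule act N -> N m -> N (- m).
Proof. by move=> [N0 NB _] Nm; rewrite -[- m]add0r; exact: NB. Qed.

Lemma submoduleD N m n : submodule act N -> N m -> N n -> N (m + n).
Proof.
move=> sN Nm Nn; rewrite -[n]opprK; have [_ NB _] := sN.
by apply: NB => //; exact: submoduleN sN Nn.
Qed.

Lemma submodule_sum N (I : Type) (r : seq I) (P : pred I) (f : I -> M) :
  submodule act N -> (forall i, P i -> N (f i)) -> N (\sum_(i <- r | P i) f i).
Proof.
move=> sN Nf; elim/big_ind: _ => //; first by case: sN.
by move=> x y; exact: submoduleD sN.
Qed.

Lemma submodule_trans N x y z : submodule act N -> N (x - y) -> N (y - z) ->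
  N (x - z).
Proof. by move=> sN Nxy Nyz; rewrite -(subrKA y); exact: submoduleD sN Nxy Nyz. Qed.

Lemma submodule_subr N x y : submodule act N -> N (x - y) -> N x <-> N y.
Proof.
move=> sN Nxy; split => [Nx|Ny].
  by rewrite -[y](subKr x); case: sN => _ NB _; exact: NB.
by rewrite -[x](subrK y); exact: submoduleD sN Nxy Ny.
Qed.

Lemma submodule_chain F : F !=set0 -> (forall X, F X -> submodule act X) ->
  total_on F subset -> submodule act (\bigcup_(X in F) X).
Proof.
move=> [X0 FX0] sF totF; split.
- by exists X0 => //; case: (sF _ FX0).
- move=> m n [X FX Xm] [Y FY Yn].
  by have [XY|YX] := totF _ _ FX FY; [exists Y|exists X] => //;
    [have [_ + _] := sF _ FY|have [_ + _] := sF _ FX]; apply => //;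
    [exact: XY|exact: YX].
- by move=> s m [X FX Xm]; exists X => //; have [_ _] := sF _ FX; apply.
Qed.

Lemma submodule_zorn C L : submodule act L -> C L ->
  (forall F, F !=set0 -> F `<=` C -> total_on F subset ->
     C (\bigcup_(X in F) X)) ->
  exists N, [/\ submodule act N, L `<=` N, C N &
    forall Q, submodule act Q -> N `<=` Q -> C Q -> Q = N].
Proof.
move=> sL CL CF; pose P A := A = set0 \/ [/\ submodule act A, L `<=` A & C A].
have [|N [PN maxN]] := @Zorn_bigcup _ P.
  move=> F FP totF; pose F' := F `&` [set~ set0].
  have UF : \bigcup_(X in F) X = \bigcup_(X in F') X.
    apply/seteqP; split => x [X]; last by move=> [FX _] Xx; exists X.
    by move=> FX Xx; exists X => //; split => // X0; rewrite X0 in Xx.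
  have [F'0|/set0P F'0] := eqVneq F' set0.
    by left; rewrite UF F'0 bigcup_set0.
  have F'P X : F' X -> [/\ submodule act X, L `<=` X & C X].
    by move=> [/FP [-> /(_ erefl)|]].
  have totF' : total_on F' subset by move=> X Y [FX _] [FY _]; exact: totF.
  right; rewrite UF; split.
  - by apply: submodule_chain => // X /F'P [].
  - have [X F'X] := F'0; have [_ LX _] := F'P _ F'X.
    by move=> x /LX Xx; exists X.
  - by apply: CF => // X /F'P [].
have [sN LN CN] : [/\ submodule act N, L `<=` N & C N].
  case: PN => // N0; exfalso; apply: (maxN L); last by right; split.
  by rewrite N0 properEneq; split => //; apply/eqP => L0; case: sL; rewrite -L0.
exists N; split => // Q sQ NQ CQ; apply: contrapT => QN.
apply: (maxN Q); last by right; split => //; exact: subset_trans NQ.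
by rewrite properEneq; split => //; apply/eqP => NQ'; exact: QN.
Qed.

(** Since [s] is finite, a chain whose union contains [s] has a member containing [s], so Zorn's
    lemma applies to the submodules that do not contain all of [s]. *)
Lemma submodule_avoid L (s : seq M) : submodule act L ->
  ~ (forall x, x \in s -> L x) ->
  exists N, [/\ submodule act N, L `<=` N, ~ (forall x, x \in s -> N x) &
    forall Q, submodule act Q -> N `<=` Q -> Q <> N -> forall x, x \in s -> Q x].
Proof.
move=> sL Ls.
have [F [X0 FX0] FC totF Us|N [sN LN Ns maxN]] :=
    @submodule_zorn (fun X => ~ (forall x, x \in s -> X x)) L sL Ls.
  suff [X FX Xs] : exists2 X, F X & forall x, x \in s -> X x by exact: FC Xs.
  elim: s {Ls FC} Us => [|x s IHs] Us; first by exists X0.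
  have [|X FX Xs] := IHs; first by move=> y ys; apply: Us; rewrite inE ys orbT.
  have [|Y FY Yx] := Us x; first by rewrite inE eqxx.
  have [XY|YX] := totF _ _ FX FY.
    by exists Y => // y; rewrite inE => /orP[/eqP->|/Xs/XY].
  by exists X => // y; rewrite inE => /orP[/eqP->|/Xs//]; exact: YX.
exists N; split => // Q sQ NQ QN; apply: contrapT => Qs.
by apply: QN; exact: maxN.
Qed.

End Submodules.

Section BiadditiveAction.
Variables (S M : zmodType) (act : S -> M -> M).
Hypotheses (actDl : forall m, {morph act^~ m : a b / a + b})
  (actDr : forall a, {morph act a : m n / m + n}).

Lemma action0l m : act 0 m = 0.
Proof. by apply: (addrI (act 0 m)); rewrite -actDl !addr0. Qed.

Lemma action0r a : act a 0 = 0.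
Proof. by apply: (addrI (act a 0)); rewrite -actDr !addr0. Qed.

Lemma actionNl a m : act (- a) m = - act a m.
Proof. by apply: (addrI (act a m)); rewrite -actDl !subrr action0l. Qed.

Lemma actionNr a m : act a (- m) = - act a m.
Proof. by apply: (addrI (act a m)); rewrite -actDr !subrr action0r. Qed.

Lemma actionBl a b m : act (a - b) m = act a m - act b m.
Proof. by rewrite actDl actionNl. Qed.

Lemma actionBr a m n : act a (m - n) = act a m - act a n.
Proof. by rewrite actDr actionNr. Qed.

End BiadditiveAction.

Section RingAction.
Variables (S : pzRingType) (M : zmodType) (act : S -> M -> M).
Hypotheses (actA : forall a b m, act (a * b) m = act a (act b m))
  (act1 : forall m, act 1 m = m)
  (actDl : forall m, {morph act^~ m : a b / a + b})
  (actDr : forall a, {morph act a : m n / m + n}).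

(** For a submodule [N] this is the sum of [N] and the cyclic submodule generated by [y]. *)
Definition coset_span (N : set M) (y : M) : set M :=
  [set z | exists a, N (z - act a y)].

Lemma coset_span_incl N y : submodule act N -> N `<=` coset_span N y.
Proof. by move=> sN z Nz; exists 0; rewrite (action0l actDl) subr0. Qed.

Lemma coset_span_mem N y : submodule act N -> coset_span N y y.
Proof. by case=> N0 _ _; exists 1; rewrite act1 subrr. Qed.

Lemma coset_span_submodule N y :
  submodule act N -> submodule act (coset_span N y).
Proof.
move=> sN; have [N0 NB Nact] := sN; split.
- exact: coset_span_incl.
- move=> m n [a Na] [b Nb]; exists (a - b).
  by rewrite (actionBl actDl) opprD addrACA -opprD; exact: NB.
- move=> s m [a Na]; exists (s * a).
  by rewrite actA -(actionBr actDr); exact: Nact.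
Qed.

(* If b w in N forces b M in N, the annihilator of w modulo N is maximal and
   kills M / N, which is thus a vector space; every line in it contains w. *)
Lemma avoid_simple N w : submodule act N -> ~ N w ->
  (forall Q, submodule act Q -> N `<=` Q -> Q <> N -> Q w) ->
  (forall b, N (act b w) -> forall v, N (act b v)) ->
  forall y z, ~ N y -> coset_span N y z.
Proof.
move=> sN Nw maxN Nann.
have [N0 NB Nact] := sN.
have spanw y : ~ N y -> coset_span N y w.
  move=> Ny; apply: maxN; first exact: coset_span_submodule.
    exact: coset_span_incl.
  by move=> E; apply: Ny; rewrite -E; exact: coset_span_mem.
move=> y z Ny; have [Nz|Nz] := pselect (N z); first exact: coset_span_incl.
have [a Na] := spanw y Ny; have [b Nb] := spanw z Nz.
have Nbw : ~ N (act b w).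
  move=> Nbw; apply: Nw; apply/(submodule_subr sN Nb); exact: Nann.
have [c Nc] := spanw _ Nbw.
have {}Nc : N (act (1 - c * b) w) by rewrite (actionBl actDl) act1 actA.
(* Modulo [N] one has z = c b z = c w = c a y. *)
exists (c * a); apply: (@submodule_trans _ _ act N _ (act (c * b) z)) => //.
  by have := Nann _ Nc z; rewrite (actionBl actDl) act1.
rewrite !actA -(actionBr actDr); apply: Nact.
apply: (@submodule_trans _ _ act N _ w) => //.
by rewrite -opprB; exact: submoduleN sN Nb.
Qed.

End RingAction.

(** * Coefficients in free modules *)

Section FreeModuleFacts.
Variable R : comPzRingType.

Lemma fmod_ind (K : choiceType) (P : fmod R K -> Prop) : P 0 ->
  (forall (r : R) k z, P z -> P (r *: fdelta k + z)) -> forall z, P z.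
Proof.
move=> P0 PD z; rewrite [z]fmod_expand.
elim: (enum_fset _) => [|g l IHl]; first by rewrite big_nil.
by rewrite big_cons; exact: PD.
Qed.

Lemma flin_coef (K K' : choiceType) (F : K -> fmod R K') z l :
  flin F z l = \sum_(k \in [set: K]) z k * F k l.
Proof.
pose ev (x : fmod R K') : R^o := x l.
have ev_lin : linear ev by move=> a x y.
pose L : {linear fmod R K' -> R^o} :=
  HB.pack ev (GRing.isLinear.Build R _ R^o *:%R ev ev_lin).
by rewrite -[LHS]/(L (flin F z)) flin_comp.
Qed.

Lemma flin_coef_inj (K K' : choiceType) (i : K -> K') z k : injective i ->
  flin (fun l => fdelta (i l) : fmod R K') z (i k) = z k.
Proof.
move=> injI; rewrite flin_coef -(@fsbig_widen _ _ _ _ [set k])//.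
  by rewrite fsbig_set1 fdeltaE eqxx mulr1.
move=> l /= [_ lk]; rewrite fdeltaE (inj_eq injI) eq_sym.
by case: eqP => [/lk//|_]; rewrite mulr0.
Qed.

(** Exchanging the two sums leaves, for each [k], the push-forward of [z] along the bijection
    [F^~ k]. Right multiplication in the group ring and the right action on [star u] are both
    instances. *)
Lemma flin_action_coef (K T : choiceType) (F F' : T -> K -> T) (s : fmod R K)
    (z : fmod R T) b :
  (forall k, cancel (F^~ k) (F'^~ k)) -> (forall k, cancel (F'^~ k) (F^~ k)) ->
  flin (fun a => flin (fun k => fdelta (F a k)) s) z b =
    \sum_(k \in [set: K]) s k * z (F' b k).
Proof.
move=> FK F'K; rewrite flin_swap flin_coef; apply: eq_fsbigr => k _.
rewrite -{1}(F'K k b) (flin_coef_inj (i := F^~ k))//.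
exact: can_inj (FK k).
Qed.

End FreeModuleFacts.

(** * Group ring modules over an Artinian ring *)

Section GroupRingModules.
Variables (R : comPzRingType) (G : groupType).
Implicit Types (r : R) (s t : gring R G) (g h : G).

Lemma gring_scaleAl r s t : (r *: s) * t = r *: (s * t) :> gring R G.
Proof. exact: (linearZ_LR (flin _)). Qed.

Lemma gring_scaleAr r s t : s * (r *: t) = r *: (s * t) :> gring R G.
Proof.
rewrite [LHS]/GRing.mul /= /gring_mul -flinZ.
by apply: eq_flin => g; rewrite linearZ.
Qed.

Definition gscal r : gring R G := r *: (1 : gring R G).

Lemma gscalE r s : gscal r * s = r *: s.
Proof. by rewrite gring_scaleAl mul1r. Qed.

Lemma gscalC r s : s * gscal r = gscal r * s.
Proof. by rewrite gscalE gring_scaleAr mulr1. Qed.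

Lemma gring_delta_mul g h :
  (fdelta g : gring R G) * fdelta h = fdelta (g * h)%g.
Proof. exact: gring_mul_delta. Qed.

Lemma gring_mulE s t g :
  (s * t) g = \sum_(k \in [set: G]) t k * s (g * k^-1)%g.
Proof.
apply: (flin_action_coef (F := fun a k => (a * k)%g)
  (F' := fun a k => (a * k^-1)%g)).
  by move=> k a; rewrite mulgK.
by move=> k a; rewrite mulgVK.
Qed.

Variable V : lmodType (gring R G).
Implicit Types (v w y z : V) (N : set V).

(** [V] is declared as a module over the group ring only; this is the restriction of its scalars to
    [R] along [gscal]. *)
Definition ract r v : V := gscal r *: v.

Lemma ractA a b v : ract (a * b) v = ract a (ract b v).
Proof. by rewrite /ract scalerA gscalE scalerA. Qed.

Lemma ract1 v : ract 1 v = v.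
Proof. by rewrite /ract /gscal scale1r scale1r. Qed.

Lemma ractDl v : {morph ract^~ v : a b / a + b}.
Proof. by move=> a b; rewrite /ract /gscal scalerDl scalerDl. Qed.

Lemma ractDr r : {morph ract r : v w / v + w}.
Proof. by move=> v w; rewrite /ract scalerDr. Qed.

Lemma ract_scale r s v : ract r (s *: v) = s *: ract r v.
Proof. by rewrite /ract !scalerA gscalC. Qed.

Lemma scale_scale r s v : (r *: s) *: v = ract r (s *: v).
Proof. by rewrite /ract scalerA gscalE. Qed.

Definition gmodule N := submodule (fun s v => s *: v) N.

Lemma gmodule_ract N : gmodule N -> submodule ract N.
Proof. by move=> [N0 NB Ns]; split => // r v; exact: Ns. Qed.

Lemma gmoduleP N : submodule ract N ->
  (forall g v, N v -> N ((fdelta g : gring R G) *: v)) -> gmodule N.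
Proof.
move=> sN Ng; have [N0 NB Nr] := sN; split => // s v Nv.
elim/fmod_ind: s => [|r g s IHs]; first by rewrite scale0r.
rewrite scalerDl scale_scale; apply: (submoduleD sN) => //.
by apply: Nr; exact: Ng.
Qed.

(** If no member were minimal, iterating a choice of strictly smaller members would give a strictly
    descending sequence of ideals. *)
Lemma artinian_min (C : set (set R)) : artinian R -> C !=set0 ->
  (forall I, C I -> ideal I) ->
  exists2 I, C I & forall J, C J -> J `<=` I -> J = I.
Proof.
move=> artR [I0 CI0] Cid; apply: contrapT => nmin.
have next I : exists J, C I -> [/\ C J, J `<=` I & J <> I].
  have [CI|] := pselect (C I); last by exists I0.
  apply: contrapT => nJ; apply: nmin; exists I => // J CJ JI.
  by apply: contrapT => JnI; apply: nJ; exists J.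
have [f fP] := choice next.
pose X n := iter n f I0.
have CX n : C (X n) by elim: n => //= n /fP [].
have [|n|n XE] := artR X; first by move=> n; exact: Cid.
  by have [] := fP _ (CX n).
have [_ _] := fP _ (CX n); apply; exact: (XE n.+1).
Qed.

(* x generates a minimal ideal not annihilating V. *)
Lemma artinian_maximal_ideal : artinian R -> (exists v : V, v <> 0) ->
  exists (x : R) (m : set R),
    [/\ maximal_ideal m, forall r, ~ m r -> exists a, m (1 - a * r),
        forall r v, m r -> ract (x * r) v = 0 & exists v, ract x v <> 0].
Proof.
move=> artR [v1 v1N0].
pose C I := ideal I /\ exists r v, I r /\ ract r v <> 0.
have prC (y : R) v : ract y v <> 0 -> C [set z | exists a, z = a * y].
  move=> yv; split; last by exists y, v; split => //; exists 1; rewrite mul1r.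
  split; first by exists 0; rewrite mul0r.
    by move=> _ _ [a ->] [b ->]; exists (a + b); rewrite mulrDl.
  by move=> a _ [b ->]; exists (a * b); rewrite mulrA.
have [||I [idI [x [v [Ix xv]]]] minI] := artinian_min artR (C := C).
- exists setT; split; first by split.
  by exists 1, v1; rewrite ract1.
- by move=> I [].
have [I0 ID IM] := idI.
(* [m] is the annihilator in [R] of x V. *)
pose m := [set r | forall v, ract (r * x) v = 0].
have mid : ideal m.
  split => [w|a b ma mb w|a b mb w]; rewrite /= ?mul0r.
  - exact: (action0l ractDl).
  - by rewrite mulrDl ractDl ma mb addr0.
  - by rewrite -mulrA ractA mb; exact: (action0r ractDr).
have minv r : ~ m r -> exists a, m (1 - a * r).
  move=> /existsNP [w rxw].
  (* By minimality [r * x] generates the whole of [I], which contains [x]; hence [a] inverts [r]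
     modulo [m]. *)
  have [a xE] : [set z | exists a, z = a * (r * x)] x.
    rewrite (minI _ (prC _ _ rxw))// => _ [a ->]; exact/IM/IM.
  exists a => z; rewrite mulrBl mul1r -mulrA -xE subrr.
  exact: (action0l ractDl).
exists x, m; split => //; last by exists v.
- split => // [mT|J [J0 JD JM] mJ].
    have m1 : m 1 by rewrite mT.
    by apply: xv; have := m1 v; rewrite mul1r.
  have [Jm|/existsNP[r /not_implyP[Jr mr]]] := pselect (J `<=` m).
    by left; apply/seteqP.
  right; apply/seteqP; split => // b _; have [a ma] := minv r mr.
  rewrite -[b]mulr1 -[1](subrK (a * r)); apply/JM/JD; last exact: JM.
  exact: mJ.
- by move=> r w mr; rewrite mulrC.
Qed.

(** [L] is the kernel of [x] on [V], so V / L is isomorphic to x V, a nonzero vector space over R /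
    m, and [H] is the preimage of a hyperplane that misses [v0]. Scalars are central, so [L] is
    stable under the group ring; [H] is only an R-submodule. *)
Lemma maximal_hyperplane : artinian R -> (exists v : V, v <> 0) ->
  exists (m : set R) (L H : set V) (v0 : V),
    [/\ maximal_ideal m, forall r, ~ m r -> exists a, m (1 - a * r),
        gmodule L, forall r v, m r -> L (ract r v) &
        [/\ submodule ract H, L `<=` H, ~ H v0 &
            forall y z, ~ H y -> exists r, H (z - ract r y)]].
Proof.
move=> artR V0; have [x [m [mm minv xm [v0 xv0]]]] := artinian_maximal_ideal artR V0.
pose L := [set v | ract x v = 0].
have gL : gmodule L.
  split; first exact: (action0r ractDr).
    by move=> v w Lv Lw; rewrite /L /= (actionBr ractDr) Lv Lw subrr.
  by move=> s v Lv; rewrite /L /= ract_scale Lv scaler0.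
have mL r v : m r -> L (ract r v) by move=> mr; rewrite /L /= -ractA xm.
have sL := gmodule_ract gL.
have [|H [sH LH Hv0 maxH]] := submodule_avoid (s := [:: v0]) sL.
  by move=> /(_ v0 (mem_head _ _)).
have {}Hv0 : ~ H v0 by move=> Hv; apply: Hv0 => y; rewrite inE => /eqP->.
exists m, L, H, v0; split => //; split => //.
move=> y z Hy; apply: (avoid_simple ractA ract1 ractDl ractDr sH Hv0) => //.
  by move=> Q sQ HQ QH; apply: maxH QH _ _ => //; rewrite mem_head.
move=> b Hb v; have [mb|/minv [a ma]] := pselect (m b).
  by apply: LH; exact: mL.
(* As [b] is invertible modulo [m], having [b v0] in [H] would force [v0] into [H]. *)
exfalso; apply: Hv0.
have : H (ract (1 - a * b) v0) by apply: LH; exact: mL.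
rewrite (actionBl ractDl) ract1 ractA => Hab; apply/(submodule_subr sH Hab).
by have [_ _] := sH; apply.
Qed.

End GroupRingModules.

Arguments ract {R G V}.

(** * Finite subgroups and the invertibility of their orders *)

Section FiniteSubgroup.
Variables (G : groupType) (H : {fset G}).

(** The proof [sH] is a phantom parameter on which the group structure depends. The resulting finite
    group type gives access to Cauchy's theorem. *)
Definition fsubgroup (sH : subgroup [set` H]) : Type := H.
Variable sH : subgroup [set` H].
Local Notation gT := (fsubgroup sH).
HB.instance Definition _ := Finite.copy gT H.

Let one_sub : 1%g \in H. Proof. by case: sH. Qed.
Let mul_sub (x y : gT) : (fsval x * fsval y)%g \in H.
Proof. by case: sH => _ HM _; apply: HM; exact: fsvalP. Qed.
Let inv_sub (x : gT) : (fsval x)^-1%g \in H.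
Proof. by case: sH => _ _ HV; apply: HV; exact: fsvalP. Qed.

Definition fsubgroup_one : gT := FSetSub one_sub.
Definition fsubgroup_mul (x y : gT) : gT := FSetSub (mul_sub x y).
Definition fsubgroup_inv (x : gT) : gT := FSetSub (inv_sub x).

Lemma fsubgroup_mulA : associative fsubgroup_mul.
Proof. by move=> x y z; apply: val_inj; rewrite /= mulgA. Qed.
Lemma fsubgroup_mul1g : left_id fsubgroup_one fsubgroup_mul.
Proof. by move=> x; apply: val_inj; rewrite /= mul1g. Qed.
Lemma fsubgroup_mulg1 : right_id fsubgroup_one fsubgroup_mul.
Proof. by move=> x; apply: val_inj; rewrite /= mulg1. Qed.
Lemma fsubgroup_mulVg : left_inverse fsubgroup_one fsubgroup_inv fsubgroup_mul.
Proof. by move=> x; apply: val_inj; rewrite /= mulVg. Qed.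
Lemma fsubgroup_mulgV : right_inverse fsubgroup_one fsubgroup_inv fsubgroup_mul.
Proof. by move=> x; apply: val_inj; rewrite /= mulgV. Qed.
HB.instance Definition _ := isGroup.Build gT
  fsubgroup_mulA fsubgroup_mul1g fsubgroup_mulg1 fsubgroup_mulVg fsubgroup_mulgV.

Lemma fsubgroup_valM (x y : gT) : fsval (x * y)%g = (fsval x * fsval y)%g.
Proof. by []. Qed.
Lemma fsubgroup_valX (x : gT) n : fsval (x ^+ n)%g = (fsval x ^+ n)%g.
Proof. by elim: n => // n IHn; rewrite !expgS fsubgroup_valM IHn. Qed.

Lemma fsubgroup_order (x : gT) : has_order (fsval x) #[x]%g.
Proof.
split; first exact: fingroup.order_gt0.
  by rewrite -fsubgroup_valX expg_order.
move=> n n0 xn; apply: dvdn_leq => //; rewrite order_dvdn; apply/eqP.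
by apply: val_inj; rewrite [LHS]fsubgroup_valX xn.
Qed.

End FiniteSubgroup.

(** Otherwise the order of [H] lies in [m], and since [m] is prime so does some prime p dividing it.
    Cauchy's theorem gives an element of order p, so p is a unit modulo the Jacobson radical, hence
    modulo [m]: a contradiction. *)
Lemma card_unit_mod (R : comPzRingType) (G : groupType) (H : {fset G})
    (m : set R) : subgroup [set` H] -> maximal_ideal m ->
  (forall r, ~ m r -> exists a, m (1 - a * r)) ->
  (forall g n, g \in H -> has_order g n ->
     unit_mod (jacobson_radical R) n%:R) ->
  exists a, m (1 - a * #|` H|%:R).
Proof.
move=> sH mm minv hH; apply: (minv); have [mid mT _] := mm.
have [m0 mD mM] := mid.
have m1 : ~ m 1.
  by move=> m1; apply: mT; apply/seteqP; split => // x _; rewrite -[x]mulr1; exact: mM.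
have mprime a b : m (a * b) -> m a \/ m b.
  move=> mab; have [|/minv [c mc]] := pselect (m a); [by left|right].
  rewrite -[b]mul1r -[1](subrK (c * a)) mulrDl -mulrA; apply: mD; last exact: mM.
  by rewrite mulrC; exact: mM.
suff mcard n : (0 < n)%N -> m n%:R -> exists p, [/\ prime p, (p %| n)%N & m p%:R].
  have H0 : (0 < #|` H|)%N by rewrite cardfs_gt0; apply/fset0Pn; exists 1%g; case: sH.
  move=> /(mcard _ H0) [p [pp pH mp]].
  have cardH : #|[set: fsubgroup sH]%G| = #|` H| by rewrite cardsT cardfE.
  have [|x _ xp] := @Cauchy _ p [set: fsubgroup sH]%G pp; first by rewrite cardH.
  have := fsubgroup_order x; rewrite xp => /(hH _ _ (fsvalP x)) [y /(_ m mm) Jy].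
  apply: m1; rewrite -[1](subKr (p%:R * y)) -mulN1r.
  by apply: mD; [rewrite mulrC; exact: mM|exact: mM].
(* Strong induction: the prime ideal [m] contains either the smallest prime factor of [n] or the
   cofactor. *)
have [k] := ubnP n; elim: k n => // k IHk n nk n0 mn.
have n1 : (1 < n)%N by case: n n0 mn {nk} => // -[].
have [|mp|] := mprime (pdiv n)%:R (n %/ pdiv n)%:R.
- by rewrite -natrM mulnC divnK ?pdiv_dvd.
- by exists (pdiv n); split => //; [exact: pdiv_prime|exact: pdiv_dvd].
move=> mq; have [|||p [pp pn mp]] := IHk (n %/ pdiv n)%N.
- apply: (@leq_trans n) => //; apply: ltn_Pdiv => //.
  by rewrite prime_gt1// pdiv_prime.
- by rewrite divn_gt0 ?pdiv_gt0// dvdn_leq// pdiv_dvd.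
- by [].
- by exists p; split => //; apply: dvdn_trans pn (dvdn_div _); exact: pdiv_dvd.
Qed.

(** * Maximal submodules for finite and for locally finite abelian groups *)

Section MaximalSubmodules.
Variables (R : comPzRingType) (G : groupType) (V : lmodType (gring R G)).
Implicit Types (r : R) (s t : gring R G) (g h : G) (v w y z : V) (N P Q : set V).
Hypotheses (artR : artinian R) (V0 : exists v : V, v <> 0).

Definition max_gmodule P := [/\ gmodule P, P <> setT &
  forall Q, gmodule Q -> P `<=` Q -> Q = P \/ Q = setT].

(** [K gs] is the intersection of the translates of the hyperplane [H] by the inverses of the
    elements of [gs]. Each translate raises the codimension by at most one, so finitely many vectors
    generate [V] modulo the full intersection; a submodule maximal among those containing it but not
    all these vectors is maximal. *)
Lemma max_gmodule_finite : finite_set [set: G] -> exists P, max_gmodule P.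
Proof.
move=> finG.
have [m [L [H [v0 [_ _ _ _ [sH _ Hv0 Hspan]]]]]] := maximal_hyperplane artR V0.
have [H0 HB Hr] := sH.
pose K (gs : seq G) :=
  [set v | forall g, g \in gs -> H ((fdelta g : gring R G) *: v)].
have sK gs : submodule ract (K gs).
  split => [g _|v w Kv Kw g gs_g|r v Kv g gs_g]; first by rewrite scaler0.
    by rewrite scalerBr; apply: HB; [exact: Kv|exact: Kw].
  by rewrite -ract_scale; apply/Hr/Kv.
have finK gs : exists F : seq V, forall Q, submodule ract Q -> K gs `<=` Q ->
    (forall x, x \in F -> Q x) -> Q = setT.
  elim: gs => [|g gs [F IH]].
    by exists [::] => Q _ KQ _; apply/seteqP; split => // v _; exact: KQ.
  have [KH|] := pselect (K gs `<=` [set v | H ((fdelta g : gring R G) *: v)]).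
    exists F => Q sQ KQ FQ; apply: IH => // v Kv; apply: KQ => h.
    by rewrite inE => /orP[/eqP->|]; [exact: KH|exact: Kv].
  (* The new translate cuts [K gs] properly, and one further generator [x] makes up for it:
     subtracting a multiple of [x] brings any vector of [K gs] into the smaller intersection. *)
  move=> /existsNP [x /not_implyP [Kx Hx]]; exists (x :: F) => Q sQ KQ FQ.
  apply: IH => // [v Kv|y Fy]; last by apply: FQ; rewrite inE Fy orbT.
  have [r Hrv] := Hspan _ ((fdelta g : gring R G) *: v) Hx.
  rewrite -[v](subrK (ract r x)); apply: (submoduleD sQ); last first.
    by have [_ _ Qr] := sQ; apply: Qr; apply: FQ; rewrite inE eqxx.
  apply: KQ => h; rewrite inE => /orP[/eqP->|gs_h].
    by rewrite scalerBr -ract_scale.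
  by have [_ KB Kr] := sK gs; apply: KB => //; exact: Kr.
have [gs gsE] : exists gs : seq G, [set: G] = [set` gs].
  by move/finite_seqP: finG.
have memgs g : g \in gs by have : [set: G] g by []; rewrite gsE.
have gK : gmodule (K gs).
  by apply: gmoduleP => // g v Kv h _; rewrite scalerA gring_delta_mul; exact: Kv.
have [F FK] := finK gs.
have [|P [gP KP FP maxP]] := submodule_avoid (s := F) gK.
  move=> /(FK _ (sK gs) (@subset_refl _ _)) KT.
  have : K gs v0 by rewrite KT.
  by move=> /(_ 1%g (memgs _)); rewrite scale1r.
exists P; split => // [PT|Q gQ PQ]; first by apply: FP => x _; rewrite PT.
have [->|QP] := pselect (Q = P); [by left|right].
apply: FK; [exact: gmodule_ract|exact: subset_trans PQ|exact: maxP].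
Qed.

(* Maschke's averaging argument: averaging an R-linear projection of the group
   ring onto a complement of the annihilator of v0 modulo N over a finite
   subgroup containing the support of b yields e with e v0 = v0 and b e = 0
   modulo N. *)
Lemma max_gmodule_locally_finite : locally_finite G ->
  (forall g h, (g * h)%g = (h * g)%g) ->
  (forall g n, has_order g n -> unit_mod (jacobson_radical R) n%:R) ->
  exists P, max_gmodule P.
Proof.
move=> locG comG ordG.
have [m [L [H0 [v0 [mm minv gL mL [_ LH Hv0 _]]]]]] := maximal_hyperplane artR V0.
have mulC s t : s * t = t * s.
  elim/fmod_ind: s => [|a g s IHs]; first by rewrite mul0r mulr0.
  rewrite mulrDl mulrDr {}IHs gring_scaleAl gring_scaleAr; congr (_ *: _ + _).
  elim/fmod_ind: t => [|b h t IHt]; first by rewrite mul0r mulr0.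
  rewrite mulrDl mulrDr IHt gring_scaleAl gring_scaleAr; congr (_ *: _ + _).
  by rewrite !gring_delta_mul comG.
have [|N [gN LN Nv0 maxN]] := submodule_avoid (s := [:: v0]) gL.
  by move=> /(_ v0 (mem_head _ _)) /LH.
have {}Nv0 : ~ N v0 by move=> Nv; apply: Nv0 => y; rewrite inE => /eqP->.
have {}maxN Q : gmodule Q -> N `<=` Q -> Q <> N -> Q v0.
  by move=> gQ NQ QN; apply: (maxN Q) => //; rewrite mem_head.
have [N0 NB Ns] := gN.
(* [C] is the annihilator of V / N and [B] that of [v0] modulo [N]. Once [B] is shown to lie in [C],
   [avoid_simple] gives the maximality of [N]. *)
pose C := [set a : gring R G | forall v, N (a *: v)].
pose B := [set a : gring R G | N (a *: v0)].
pose act (r : R) (s : gring R G) : gring R G := r *: s.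
have sC : submodule act C.
  split => [v|a b Ca Cb v|r a Ca v]; first by rewrite scale0r.
    by rewrite scalerBl; exact: NB.
  by rewrite scale_scale; exact: Ns.
have BB : submodule act B.
  split; first by rewrite /B /= scale0r.
    by move=> a b Ba Bb; rewrite /B /= scalerBl; exact: NB.
  by move=> r a Ba; rewrite /B /= scale_scale; exact: Ns.
have Cmul s a : C a -> C (s * a) by move=> Ca v; rewrite -scalerA; exact: Ns.
have mC r a : m r -> C (r *: a).
  by move=> mr v; rewrite scale_scale; apply: LN; exact: mL.
have CB : C `<=` B by move=> a; exact.
(* [E] is an R-linear complement of [B] modulo [C], obtained as a maximal submodule containing [C]
   and meeting [B] inside [C]. *)
have [|F F0 FC totF|E [sE CE EBC maxE]] :=
    submodule_zorn (C := fun X => X `&` B `<=` C) sC.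
- by move=> a [].
- by move=> a [[X FX Xa] Ba]; exact: (FC X).
have [E0 EB Er] := sE.
have EBT a : exists e, E e /\ B (a - e).
  have [Ea|Ea] := pselect (E a).
    by exists a; split => //; rewrite /B /= subrr scale0r.
  pose E' := [set x | exists r e, E e /\ x = e + r *: a].
  (* Adjoining [a] to [E] violates maximality, so some e + r a lies in [B] but not in [C]. Then [r]
     is not in [m], and dividing by it modulo [m] writes [a] as a sum from [E] and [B]. *)
  have [x [[[r [e [Ee ->]]] Bx] Cx]] : exists x, (E' `&` B) x /\ ~ C x.
    apply: contrapT => nx; apply: Ea; suff <- : E' = E.
      by exists 1, 0; rewrite scale1r add0r.
    apply: maxE.
    - split => [|_ _ [r [e [Ee ->]]] [r' [e' [Ee' ->]]]|b _ [r [e [Ee ->]]]].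
      + by exists 0, 0; rewrite scale0r addr0.
      + exists (r - r'), (e - e'); split; first exact: EB.
        by rewrite scalerBl opprD addrACA.
      + exists (b * r), (b *: e); split; first exact: Er.
        by rewrite /act scalerDr scalerA.
    - by move=> e Ee; exists 0, e; rewrite scale0r addr0.
    - by move=> x E'x; apply: contrapT => Cx; apply: nx; exists x.
  have mr : ~ m r.
    move=> mr; have Cra := mC r a mr; apply: Cx; apply: EBC; split => //.
    by apply: (submoduleD sE) => //; exact: CE.
  have [c mc] := minv r mr; exists (- (c *: e)); split.
    by apply: (submoduleN sE); exact: Er.
  have -> : a - - (c *: e) = (1 - c * r) *: a + c *: (e + r *: a).
    by rewrite opprK scalerBl scale1r scalerDr scalerA addrA addrAC addrNK addrC.
  apply: (submoduleD BB); first by apply: CB; exact: mC.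
  by have [_ _ Bs] := BB; exact: Bs.
(* [rho] chooses a component in [E]; it is R-linear only modulo [C], and there it is the projection
   onto [E] along [B]. *)
have [rho /all_and2 [Erho Brho]] := choice EBT.
have EB_C a : E a -> B a -> C a by move=> Ea Ba; exact: EBC.
have rhoB b : B b -> C (rho b).
  by move=> Bb; apply: EB_C => //; apply/(submodule_subr BB (Brho b)).
have rhoD a r b : C (rho (r *: a + b) - (r *: rho a + rho b)).
  have ? : E (r *: rho a + rho b) by apply: (submoduleD sE) => //; exact: Er.
  apply: EB_C; first exact: EB.
  apply: (@submodule_trans _ _ _ _ _ (r *: a + b)) => //; first exact: BB.
    by rewrite -opprB; apply: (submoduleN BB).
  rewrite opprD addrACA -scalerBr; apply: (submoduleD BB) => //.
  by have [_ _ Bs] := BB; exact: Bs.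
have rho0 : C (rho 0) by apply: rhoB; case: BB.
have actA (a b : gring R G) v : (a * b) *: v = a *: (b *: v) by rewrite scalerA.
have act1 v : (1 : gring R G) *: v = v by rewrite scale1r.
have actDl v : {morph (fun a : gring R G => a *: v) : a b / a + b}.
  by move=> a b; rewrite scalerDl.
have actDr (a : gring R G) : {morph (fun v => a *: v) : v w / v + w}.
  by move=> v w; rewrite scalerDr.
have annN b : N (b *: v0) -> forall v, N (b *: v).
  move=> Bb.
  have [H sH bH] : exists2 H : {fset G}, subgroup [set` H] &
      forall g, b g != 0 -> g \in H.
    have finb : finite_set [set g | b g != 0] by exact: fmod_finite.
    have finH := locG _ finb; exists (fset_set (smallest (@subgroup G) [set g | b g != 0])).
      rewrite fset_setK//; split.
      - by move=> K [[]].
      - by move=> g h Hg Hh K KP; have [[_ KM _] _] := KP; apply: KM;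
          [exact: Hg KP|exact: Hh KP].
      - by move=> g Hg K KP; have [[_ _ KV] _] := KP; apply: KV; exact: Hg KP.
    by move=> g bg; rewrite in_fset_set//; apply/mem_set => K [_]; exact.
  have [i mi] : exists i, m (1 - i * #|` H|%:R).
    by apply: card_unit_mod sH mm minv _ => g n _; exact: ordG.
  pose d (h : fsubgroup sH) : gring R G := fdelta (fsval h).
  have dM (h k : fsubgroup sH) : d (h * k)%g = d h * d k by rewrite gring_delta_mul.
  have dV (h : fsubgroup sH) : d h * d h^-1%g = 1.
    by rewrite -dM mulgV.
  (* This is the value at 1 of the average over [H] of the conjugates of [rho]. As [rho] moves
     elements only by elements of the left ideal [B], [e] is congruent to 1 modulo [B]. *)
  pose e : gring R G := i *: \sum_(h : fsubgroup sH) d h * rho (d h^-1%g).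
  have sumd (x : gring R G) : \sum_(h : fsubgroup sH) x = #|` H|%:R *: x.
    by rewrite sumr_const cardfE scaler_nat.
  have Be : B (1 - e).
    have -> : 1 - e = (1 - i * #|` H|%:R) *: (1 : gring R G) +
        i *: \sum_(h : fsubgroup sH) d h * (d h^-1%g - rho (d h^-1%g)).
      under eq_bigr do rewrite mulrBr dV.
      rewrite sumrB sumd scalerBr -/e scalerA addrA scalerBl scale1r.
      by rewrite subrK.
    apply: (submoduleD BB); first by apply: CB; exact: mC.
    have [_ _ Bs] := BB; apply: Bs; refine (@submodule_sum _ _ _ B _ _ _ _ BB _) => h _.
    by rewrite /B /= -scalerA; apply: Ns; exact: Brho.
  have rho_sum (I : Type) (l : seq I) (c : I -> R) (F : I -> gring R G) :
      C (rho (\sum_(g <- l) c g *: F g) - \sum_(g <- l) c g *: rho (F g)).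
    elim: l => [|g l IHl]; first by rewrite !big_nil subr0; exact: rho0.
    rewrite !big_cons; apply: (submodule_trans sC) (rhoD _ _ _) _.
    by rewrite opprD addrACA subrr add0r.
  have Cbe : C (b * e).
    have bE : b = \sum_(g : fsubgroup sH) b (fsval g) *: d g.
      rewrite -(big_seq_fsetE _ H xpredT (fun g => b g *: fdelta g)) /=.
      rewrite -flinE//; apply: (@fmod_ext _ _ _ idfun (flin _)) => g /=.
      by rewrite flin_delta.
    (* Substituting h = g^-1 k in the average gathers the coefficients of [b] under [rho]. Modulo
       [C] the inner sum is [rho] of k^-1 b, and k^-1 b lies in [B], which [rho] sends into [C]. *)
    have -> : b * e = i *: \sum_(k : fsubgroup sH)
        d k * \sum_(g : fsubgroup sH) b (fsval g) *: rho (d (k^-1 * g)%g).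
      rewrite gring_scaleAr; congr (_ *: _).
      rewrite {1}bE mulr_suml; under eq_bigr => g _.
        rewrite mulr_sumr (reindex_inj (mulgI g^-1%g)) /=.
        under eq_bigr => k _ do
          rewrite gring_scaleAl mulrA -dM mulKVg invMg invgK -gring_scaleAr.
        over.
      by rewrite exchange_big; apply: eq_bigr => k _; rewrite mulr_sumr.
    have [_ _ Cs] := sC; apply: Cs; refine (@submodule_sum _ _ _ C _ _ _ _ sC _) => k _.
    apply: Cmul; apply/(submodule_subr sC (rho_sum _ _ _ _)).
    apply: rhoB; rewrite (_ : \sum_(g <- _) _ = d k^-1%g * b).
      by rewrite /B /= -scalerA; exact: Ns.
    rewrite [in RHS]bE mulr_sumr; apply: eq_bigr => g _.
    by rewrite gring_scaleAr dM.
  (* If [b y] were outside [N], then v0 = a b y modulo [N] for some [a]; by commutativity e v0 = a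
     (b e) y lies in [N], and so does [v0]. *)
  move=> y; apply: contrapT => Nby; apply: Nv0.
  have [a Na] : coset_span (fun s v => s *: v) N (b *: y) v0.
    apply: maxN; first exact: coset_span_submodule.
      exact: coset_span_incl.
    by move=> spanN; apply: Nby; rewrite -spanN; exact: coset_span_mem.
  have Nea : N (e *: v0 - a *: ((b * e) *: y)).
    rewrite (_ : _ - _ = e *: (v0 - a *: (b *: y))); first exact: Ns.
    by rewrite scalerBr [a *: (b *: y)]scalerA !scalerA (mulC e) mulrA.
  have Nev0 : N (v0 - e *: v0) by have := Be; rewrite /B /= scalerBl scale1r.
  apply/(submodule_subr gN Nev0)/(submodule_subr gN Nea).
  by apply: Ns; exact: Cbe.
exists N; split => // [NT|Q gQ NQ]; first by apply: Nv0; rewrite NT.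
have [QN|/existsNP[y /not_implyP[Qy Ny]]] := pselect (Q `<=` N).
  by left; apply/seteqP.
right; apply/seteqP; split => // z _.
have [a Na] := avoid_simple actA act1 actDl actDr gN Nv0 maxN annN z Ny.
rewrite -[z](subrK (a *: y)); apply: (submoduleD gQ); first exact: NQ.
by have [_ _] := gQ; apply.
Qed.

End MaximalSubmodules.

(** * Quotient modules *)

Section QuotientModule.
Local Open Scope quotient_scope.
Variables (A : pzRingType) (M : zmodType) (N : set M) (act : A -> M -> M).
Hypotheses (N0 : N 0) (NB : forall m n, N m -> N n -> N (m - n))
  (Nact : forall a m, N m -> N (act a m))
  (actA : forall a b m, N (act (a * b) m - act a (act b m)))
  (act1 : forall m, N (act 1 m - m))
  (actDl : forall a b m, N (act (a + b) m - (act a m + act b m)))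
  (actBr : forall a m n, N (act a (m - n) - (act a m - act a n))).

(** The axioms of an action are required only modulo [N], because on stalks the action goes through
    arbitrary choices of functions with a given germ. *)
Lemma quotient_module : exists (V : lmodType A) (p : M -> V),
  [/\ zmod_morphism p, forall v, exists m, p m = v,
      forall m, p m = 0 <-> N m & forall a m, p (act a m) = a *: p m].
Proof.
pose memN : {pred M} := fun m => `[< N m >].
have closedN : zmod_closed memN.
  by split; [exact/asboolP|move=> x y /asboolP Nx /asboolP Ny; exact/asboolP/NB].
pose NC : zmodClosed M := HB.pack memN (GRing.isZmodClosed.Build M memN closedN).
pose Q := Quotient.quot NC.
have piE m n : \pi_Q m = \pi_Q n <-> N (m - n).
  by split=> [/eqP|Nmn]; [|apply/eqP];
    rewrite -Quotient.idealrBE; [move/asboolP|apply/asboolP].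
have piD : {morph (\pi_Q : M -> Q) : m n / m + n} by move=> m n; rewrite Quotient.pi_add.
have piN : {morph (\pi_Q : M -> Q) : m / - m} by exact: Quotient.pi_opp.
have piB : zmod_morphism (\pi_Q : M -> Q) by move=> m n; rewrite piD piN.
have pi0 : \pi_Q 0 = 0 :> Q by rewrite -(subrr (0 : M)) piB subrr.
pose scale (a : A) (v : Q) : Q := \pi_Q (act a (repr v)).
have scaleE a m : scale a (\pi_Q m) = \pi_Q (act a m).
  apply/piE; have Nm : N (repr (\pi_Q m) - m) by apply/piE; rewrite reprK.
  rewrite -[X in N X](subKr (act a (repr (\pi_Q m) - m))); apply: NB.
    exact: Nact.
  exact: actBr.
have pi_surj (v : Q) : exists m, v = \pi_Q m by exists (repr v); rewrite reprK.
have sA a b v : scale a (scale b v) = scale (a * b) v.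
  have [m ->] := pi_surj v; rewrite !scaleE; apply/esym/piE; exact: actA.
have s1 : left_id 1 scale.
  by move=> v; have [m ->] := pi_surj v; rewrite scaleE; exact/piE.
have sB a v w : scale a (v - w) = scale a v - scale a w.
  have [m ->] := pi_surj v; have [n ->] := pi_surj w.
  by rewrite -piB !scaleE -piB; exact/piE.
have sDr : right_distributive scale +%R.
  move=> a v w; have s0 : scale a 0 = 0 by rewrite -[in LHS](subrr (0 : Q)) sB subrr.
  by rewrite -[w in LHS]opprK sB -[- w]add0r sB s0 sub0r opprK.
have sDl v : {morph scale^~ v : a b / a + b}.
  by move=> a b; have [m ->] := pi_surj v; rewrite /= !scaleE -piD; exact/piE.
pose V : lmodType A := HB.pack Q (GRing.Zmodule_isLmodule.Build A Q sA s1 sDr sDl).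
exists V, (\pi_Q : M -> Q); split => //.
- by move=> v; have [m ->] := pi_surj v; exists m.
- by move=> m; rewrite -[X in _ = X]pi0 piE subr0.
Qed.

End QuotientModule.

(** * Functions on the groupoid and their germs *)

Section GroupoidAlgebraElements.
Variables (R : comPzRingType) (G : ampleGroupoid).
Local Notation A := (galg R G).
Implicit Types (x y f h : A) (c e : arr G) (u v : obj G) (B : set (arr G))
  (K : set (obj G)).

Lemma galg_eq x y : (forall c, x c = y c) -> x = y.
Proof. by move=> xy; apply/val_inj/funext. Qed.

Lemma galg0E c : (0 : A) c = 0. Proof. by []. Qed.
Lemma galgDE x y c : (x + y) c = x c + y c. Proof. by []. Qed.
Lemma galgBE x y c : (x - y) c = x c - y c. Proof. by []. Qed.
Lemma galgZE (a : R) x c : (a *: x) c = a * x c. Proof. by []. Qed.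

Lemma galg_sumE (I : Type) (r : seq I) (P : pred I) (F : I -> A) c :
  (\sum_(i <- r | P i) F i) c = \sum_(i <- r | P i) F i c.
Proof. exact: (big_morph (fun x : A => x c)). Qed.

Lemma indic_span B : bisection B -> galg_span (\1_B : arr G -> R^o).
Proof. by move=> bB; apply/galg_spanP; exact: bspan_indic. Qed.

(** The default value 0 off the bisections makes this total on plain sets, so no proof has to be
    carried in the terms. *)
Definition gind B : A :=
  if pselect (bisection B) is left bB then Galg (indic_span bB) else 0.

Lemma gindE B c : bisection B -> gind B c = (c \in B)%:R.
Proof. by rewrite /gind; case: pselect => // bB _; rewrite /gcoef/= indicE. Qed.

Lemma galg_ind (P : A -> Prop) : P 0 ->
  (forall (a : R) B f, bisection B -> P f -> P (a *: gind B + f)) ->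
  forall f, P f.
Proof.
move=> P0 PD f; have /galg_spanP bf := valP f.
elim: bf {-2}f (erefl (val f)) => [{}f f0|a B h bB bh IH {}f fE].
  by rewrite (_ : f = 0)//; exact: val_inj.
have hs : galg_span h by apply/galg_spanP.
rewrite (_ : f = a *: gind B + Galg hs); first by apply: PD => //; exact: IH.
apply: val_inj; rewrite fE /=; congr (_ *: _ + _).
by rewrite /gind; case: pselect.
Qed.

Lemma conv_ran f h c : conv f h c =
  \sum_(a \in [set a | gran a = gran c]) f a * h (gmul (ginv a) c).
Proof.
rewrite /conv (@reindex_fsbig _ _ _ _ _ (fun a => (a, gmul (ginv a) c))
  [set a | gran a = gran c])//; split => /=.
- move=> a /= ac; rewrite gran_mul ?gdom_inv// gran_inv; split => //.
  by rewrite gmulVKV.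
- by move=> a a' _ _ [].
- move=> [a b] /= [ab <-]; exists a; rewrite ?gran_mul//.
  by rewrite gmulKV.
Qed.

(** A bisection has at most one arrow with a given range, so the convolution sum has a single
    term. *)
Lemma gind_mul B f b c : bisection B -> B b -> gran b = gran c ->
  rmul (gind B) f c = f (gmul (ginv b) c).
Proof.
move=> bB Bb bc; rewrite [LHS]conv_ran.
rewrite -(@fsbig_widen _ _ _ _ [set b]) /=.
- by rewrite fsbig_set1 gindE// mem_set// mul1r.
- by move=> _ ->.
- move=> a /= [ac ab]; rewrite gindE//.
  case: (boolP (a \in B)) => [/set_mem Ba|_]; last by rewrite mul0r.
  by exfalso; apply: ab; case: bB => _ _ _; apply; rewrite ?inE// bc.
Qed.

Lemma gind_mul0 B f c : bisection B -> (forall b, B b -> gran b <> gran c) ->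
  rmul (gind B) f c = 0.
Proof.
move=> bB Bc; rewrite [LHS]conv_ran fsbig1// => a /= ac; rewrite gindE//.
by case: (boolP (a \in B)) => [/set_mem/Bc//|_]; rewrite mul0r.
Qed.

Lemma mul_gind B f b c : bisection B -> B b -> gdom b = gdom c ->
  rmul f (gind B) c = f (gmul c (ginv b)).
Proof.
move=> bB Bb bc; rewrite [LHS]convE.
rewrite -(@fsbig_widen _ _ _ _ [set b]) /=.
- by rewrite fsbig_set1 gindE// mem_set// mulr1.
- by move=> _ ->.
- move=> a /= [ac ab]; rewrite gindE//.
  case: (boolP (a \in B)) => [/set_mem Ba|_]; last by rewrite mulr0.
  by exfalso; apply: ab; case: bB => _ _ + _; apply; rewrite ?inE// bc.
Qed.

Lemma mul_gind0 B f c : bisection B -> (forall b, B b -> gdom b <> gdom c) ->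
  rmul f (gind B) c = 0.
Proof.
move=> bB Bc; rewrite [LHS]convE fsbig1// => a /= ac; rewrite gindE//.
by case: (boolP (a \in B)) => [/set_mem/Bc//|_]; rewrite mulr0.
Qed.

Lemma galg_ran_finite f u : finite_set [set c | gran c = u /\ f c != 0].
Proof.
elim/galg_ind: f => [|a B f bB IH].
  rewrite (_ : [set _ | _] = set0)// -subset0 => c [_ /eqP].
  by apply.
have fB : finite_set [set c | gran c = u /\ B c].
  pose c0 := xget (gid u) [set c | gran c = u /\ B c].
  apply: (@sub_finite_set _ _ [set c0]) => // c /= [cu Bc].
  rewrite /c0; case: xgetP => [c' -> [c'u Bc']|/(_ c) []] //.
  by case: bB => _ _ _; apply; rewrite ?inE// c'u.
have := conj fB IH; rewrite -finite_setU; apply: sub_finite_set => c [cu].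
rewrite galgDE galgZE gindE//.
have [->|f0 _] := eqVneq (f c) 0; last by right.
by case: (boolP (c \in B)) => [/set_mem|_]; [left|rewrite mulr0 addr0 eqxx].
Qed.

Let hausG : hausdorff_space (obj G). Proof. by case: (ampleP G). Qed.

Lemma finite_obj_open (F : set (obj G)) : finite_set F -> open (~` F).
Proof.
move=> finF; apply: closed_openC.
exact: (iffLR (accessible_finite_set_closed (T := obj G)) (hausdorff_accessible hausG)).
Qed.

Lemma bisection_dom_avoid c (F : set (obj G)) : finite_set F ->
  ~ F (gdom c) -> exists B, [/\ bisection B, B c & forall e, B e -> ~ F (gdom e)].
Proof.
move=> finF Fc; apply: (bisection_nbhs (W := @gdom G @^-1` ~` F)) => //.
apply: open_comp; last exact: finite_obj_open.
by move=> ? _; exact: gdom_continuous.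
Qed.

Lemma bisection_ran_avoid c (F : set (obj G)) : finite_set F ->
  ~ F (gran c) -> exists B, [/\ bisection B, B c & forall e, B e -> ~ F (gran e)].
Proof.
move=> finF Fc; apply: (bisection_nbhs (W := @gran G @^-1` ~` F)) => //.
apply: open_comp; last exact: finite_obj_open.
by move=> ? _; exact: gran_continuous.
Qed.

Lemma bisection_ex c : exists B, bisection B /\ B c.
Proof. by have [B []] := bisection_nbhs openT (I : setT c); exists B. Qed.

Lemma compact_open_nbhs u (O : set (obj G)) : nbhs u O ->
  exists K, [/\ open K, compact K, K u & K `<=` O].
Proof.
move=> uO; have [_ _ _ [BB [_ bB] BBh]] := ampleP G.
have [K [BK Ku] KO] := bB u _ uO; have [oK [cK _]] := BBh K BK.
by exists K.
Qed.

(** For openness: when c is close to a unit, both c and the unit at its domain lie in a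
    neighbourhood on which [gdom] is injective, so they coincide. *)
Lemma bisection_unit K : open K -> compact K -> bisection (@gid G @` K).
Proof.
move=> oK cK; split.
- rewrite openE => _ [u Ku <-].
  have [etG _ _ _] := ampleP G; have [U [oU Uu _ [g [_ _ gK]]]] := etG (gid u).
  have nU : nbhs (gid u) U by exact: open_nbhs_nbhs.
  have nU' : nbhs (gid u) [set c : arr G | U (gid (gdom c))].
    apply: (continuous_comp (f := @gdom G) (g := @gid G)); first exact: gdom_continuous.
      exact: gid_continuous.
    by rewrite /comp gdom_id.
  have nK : nbhs (gid u) [set c : arr G | K (gdom c)].
    by apply: gdom_continuous; rewrite gdom_id; exact: open_nbhs_nbhs.
  apply: filterS (filterI (filterI nU nU') nK) => c [[Uc U'c] Kc].
  exists (gdom c) => //; rewrite -[LHS]gK ?inE// -[RHS]gK ?inE//.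
  by rewrite gdom_id.
- apply: continuous_compact => //; apply: continuous_subspaceT => ?.
  exact: gid_continuous.
- by move=> _ _ /set_mem[u _ <-] /set_mem[v _ <-]; rewrite !gdom_id => ->.
- by move=> _ _ /set_mem[u _ <-] /set_mem[v _ <-]; rewrite !gran_id => ->.
Qed.

Definition gunit K : A := gind (@gid G @` K).

Lemma gunit_mul K f c : open K -> compact K ->
  rmul (gunit K) f c = if gran c \in K then f c else 0.
Proof.
move=> oK cK; have bK := bisection_unit oK cK.
case: ifPn => [/set_mem Kc|/negP Kc].
  rewrite (@gind_mul _ _ (gid (gran c)))//; last by rewrite gran_id.
  congr (f _); rewrite -[X in gmul _ X]gmul_idl.
  by rewrite gmulKV ?gdom_id.
by apply: gind_mul0 => // _ [v Kv <-]; rewrite gran_id => vc;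
  apply: Kc; apply/mem_set; rewrite -vc.
Qed.

Lemma gran_open B : open B -> open (@gran G @` B).
Proof.
move=> oB; rewrite (_ : _ @` _ = @gdom G @` (@ginv G @^-1` B)).
  apply: gdom_open; apply: open_comp => // ? _; exact: ginv_continuous.
apply/seteqP; split => [_ [c Bc <-]|_ [c Bc <-]].
  by exists (ginv c); rewrite /= ?ginvK// gdom_inv.
by exists (ginv c) => //; rewrite gran_inv.
Qed.

(** By induction on [f] as a combination of bisections. A bisection meeting the range fibre over [u]
    at [b] agrees with [beta b] over a neighbourhood of [u]; one missing that fibre has a compact,
    hence closed, range, which a smaller [K] avoids. *)
Lemma galg_local_form (beta : arr G -> set (arr G)) u f :
  (forall c, bisection (beta c) /\ beta c c) ->
  exists2 w : fmod R (arr G), forall c, w c = (if gran c == u then f c else 0) &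
    exists2 K, nbhs u K & forall c, K (gran c) ->
      f c = flin (fun b => (\1_(beta b) c : R^o)) w.
Proof.
move=> hb; elim/galg_ind: f => [|a B f bB [w wE [K uK fK]]].
  exists 0; first by move=> c; rewrite galg0E if_same.
  by exists setT => [|c _]; [exact: filterT|rewrite linear0].
have [oB cB dB rB] := bB.
have [[b [Bb bu]]|nb] := pselect (exists b, B b /\ gran b = u).
  exists (a *: fdelta b + w).
    move=> c; rewrite fmodDE fmodZE fdeltaE wE galgDE galgZE gindE//.
    case: (eqVneq (gran c) u) => [cu|cu].
      congr (_ * _%:R + _); congr nat_of_bool; apply/eqP/idP => [->|/set_mem Bc].
        by rewrite inE.
      by apply: rB; rewrite ?inE// bu.
    case: eqP => [cb|_]; last by rewrite mulr0 addr0.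
    by move: cu; rewrite cb bu eqxx.
  have [bb' b'b] := hb b; have [ob' _ db' rb'] := bb'.
  exists (K `&` (@gran G @` (B `&` beta b))).
    apply: filterI => //; apply: open_nbhs_nbhs; split; last by exists b.
    by apply: gran_open; exact: openI.
  move=> c [Kc [e [Be b'e] ec]].
  rewrite galgDE galgZE gindE// (fK c Kc) linearD linearZ /= flin_delta indicE.
  congr (_ * _%:R + _); congr nat_of_bool; apply/idP/idP => /set_mem cB'.
    by rewrite (_ : c = e) ?inE//; apply: rB; rewrite ?inE.
  by rewrite (_ : c = e) ?inE//; apply: rb'; rewrite ?inE.
exists w.
  move=> c; rewrite wE galgDE galgZE gindE//; case: eqP => // cu.
  case: (boolP (c \in B)) => [/set_mem Bc|]; last by rewrite mulr0 add0r.
  by exfalso; apply: nb; exists c.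
exists (K `&` ~` (@gran G @` B)).
  apply: filterI => //; apply: open_nbhs_nbhs; split; last first.
    by move=> [b Bb bu]; apply: nb; exists b.
  apply: closed_openC; apply: compact_closed => //.
  apply: continuous_compact => //; apply: continuous_subspaceT => ?.
  exact: gran_continuous.
move=> c [Kc nBc]; rewrite galgDE galgZE gindE// (fK c Kc).
case: (boolP (c \in B)) => [/set_mem Bc|]; last by rewrite mulr0 add0r.
by exfalso; apply: nBc; exists c.
Qed.

(* Near the fibre over u a function is determined by its values there, since the
   bisections through a given arrow agree near that arrow. *)
Lemma galg_vanish u f : (forall c, gran c = u -> f c = 0) ->
  exists K, [/\ open K, compact K, K u & rmul (gunit K) f = 0].
Proof.
move=> fu; have [beta hb] := choice bisection_ex.
have [w wE [O uO fO]] := galg_local_form u f hb.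
have w0 : w = 0.
  by apply: fmod_eq => c; rewrite wE; case: eqP => // /fu.
have [K [oK cK Ku KO]] := compact_open_nbhs uO.
exists K; split => //; apply: galg_eq => c; rewrite gunit_mul//.
case: ifPn => // /set_mem Kc; rewrite (fO _ (KO _ Kc)) w0.
by rewrite linear0.
Qed.

End GroupoidAlgebraElements.

Lemma isotropy_ex (G : topGroupoid) (u : obj G) (c : arr G) :
  gdom c = u -> gran c = u -> exists g : isotropy u, val g = c.
Proof.
move=> cd cr; have cu : (gdom c == u) && (gran c == u) by rewrite cd cr eqxx.
by exists (exist _ c cu).
Qed.

Section Germs.
Variables (R : comPzRingType) (G : ampleGroupoid) (u : obj G).
Local Notation A := (galg R G).
Local Notation RG := (gring R (isotropy u)).
Implicit Types (f h : A) (s t : RG) (c : arr G) (g k : isotropy u).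

(* Such an f acts as s on the stalk at u of any module. *)
Definition germ f s := (forall g, f (val g) = s g) /\
  (forall c, gran c = u -> gdom c <> u -> f c = 0).

Lemma germ0P f : germ f 0 <-> forall c, gran c = u -> f c = 0.
Proof.
split=> [[f0 f1] c cr|f0]; last by split=> [g|c]; [rewrite f0// isotropy_ran|move=> /f0].
have [cd|] := pselect (gdom c = u); last exact: f1.
by have [g <-] := isotropy_ex cd cr; rewrite f0.
Qed.

Lemma germD f h s t : germ f s -> germ h t -> germ (f + h) (s + t).
Proof.
move=> [fs f0] [ht h0]; split => [g|c cr cd].
  by rewrite galgDE fmodDE fs ht.
by rewrite galgDE f0// h0// addr0.
Qed.

Lemma germZ (a : R) f s : germ f s -> germ (a *: f) (a *: s).
Proof.
move=> [fs f0]; split => [g|c cr cd]; first by rewrite galgZE fmodZE fs.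
by rewrite galgZE f0// mulr0.
Qed.

Lemma germB f h s t : germ f s -> germ h t -> germ (f - h) (s - t).
Proof. by move=> fs ht; apply: germD => //; rewrite -!scaleN1r; exact: germZ. Qed.

Lemma germ_gind B g : bisection B -> B (val g) -> germ (gind R B) (fdelta g).
Proof.
move=> bB Bg; have [_ _ dB rB] := bB; split => [k|c cr cd].
  rewrite gindE// fdeltaE; congr (_ %:R); congr nat_of_bool.
  apply/idP/eqP => [/set_mem Bk|->]; last by rewrite inE.
  by apply: val_inj; apply: rB; rewrite ?inE// !isotropy_ran.
rewrite gindE//; case: (boolP (c \in B)) => // /set_mem Bc.
exfalso; apply: cd; rewrite (_ : c = val g) ?isotropy_dom//.
by apply: rB; rewrite ?inE// isotropy_ran.
Qed.

Lemma germ_ex s : exists f, germ f s.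
Proof.
elim/fmod_ind: s => [|a g s [f fs]]; first by exists 0; apply/germ0P.
have [B [bB Bg]] := bisection_ex (val g).
by exists (a *: gind R B + f); apply: germD => //; apply: germZ; exact: germ_gind.
Qed.

Lemma germ_gunit K : open K -> compact K -> K u -> germ (gunit R K) 1.
Proof.
move=> oK cK Ku; apply: (@germ_gind _ 1%g); first exact: bisection_unit.
by exists u.
Qed.

(** In the convolution at an arrow with range [u], a term survives only if its second factor has
    range [u], by the condition on [f], and then domain [u], by the condition on [h]. What remains
    is the product in the group ring. *)
Lemma germM f h s t : germ f s -> germ h t -> germ (rmul f h) (s * t).
Proof.
move=> [fs f0] [ht h0].
have f0' c b : gran c = u -> gdom b = gdom c -> gran b <> u ->
    f (gmul c (ginv b)) = 0.
  move=> cr bc br; apply: f0; first by rewrite gran_mul// gran_inv.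
  by rewrite gdom_mul ?gran_inv// gdom_inv.
split => [g|c cr cd]; last first.
  rewrite [LHS]convE fsbig1// => b /= bc.
  have [br|br] := pselect (gran b = u); last by rewrite f0' ?mul0r.
  by rewrite h0 ?mulr0// bc.
rewrite [LHS]convE gring_mulE isotropy_dom.
rewrite -(@fsbig_widen _ _ _ _ [set b | gdom b = u /\ gran b = u]) /=; last 2 first.
- by move=> b [].
- move=> b /= [bd nb]; rewrite f0' ?mul0r ?isotropy_ran ?isotropy_dom//.
  by move=> br; apply: nb.
rewrite (@reindex_fsbig _ _ _ _ _ (fun k : isotropy u => val k) [set: isotropy u]).
  by apply: eq_fsbigr => k _; rewrite -ht -fs mulrC.
split.
- by move=> k _ /=; rewrite isotropy_dom isotropy_ran.
- by move=> k k' _ _ /val_inj.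
- by move=> b /= [bd br]; have [k <-] := isotropy_ex bd br; exists k.
Qed.

End Germs.

Arguments germ {R G} u f s.

(** * Stalks of a module *)

Section Stalks.
Variables (R : comPzRingType) (G : ampleGroupoid) (M : rngModType (galg R G)).
Local Notation A := (galg R G).
Implicit Types (u : obj G) (K : set (obj G)) (f h : A) (m n : M).

Let mod0l m : modact (0 : A) m = 0. Proof. exact: (action0l modactDl). Qed.
Let mod0r f : modact f (0 : M) = 0. Proof. exact: (action0r modactDr). Qed.
Let modBl m f h : modact (f - h) m = modact f m - modact h m.
Proof. exact: (actionBl modactDl). Qed.
Let modBr f m n : modact f (m - n) = modact f m - modact f n.
Proof. exact: (actionBr modactDr). Qed.

(* M modulo the sections germ_zero u is the stalk of M at u. *)
Definition germ_zero u : set M := [set n |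
  exists K, [/\ open K, compact K, K u & modact (gunit R K) n = 0]].

Lemma gunit_subset K K' : open K -> compact K -> open K' -> compact K' ->
  K `<=` K' -> rmul (gunit R K) (gunit R K') = gunit R K.
Proof.
move=> oK cK oK' cK' KK'; apply: galg_eq => c; rewrite gunit_mul//.
have bK := bisection_unit oK cK; have bK' := bisection_unit oK' cK'.
rewrite [gunit R K' c]gindE// [gunit R K c]gindE//.
case: (boolP (gran c \in K)) => [/set_mem Kc|Kc].
  congr (_%:R); congr nat_of_bool; apply/idP/idP => /set_mem [v Kv vc].
    by apply/mem_set; exists v => //; rewrite -vc gran_id in Kc.
  by apply/mem_set; exists v => //; exact: KK'.
case: (boolP (c \in _)) => // /set_mem [v Kv vc].
by case/negP: Kc; rewrite -vc gran_id; exact/mem_set.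
Qed.

Lemma compact_objI K K' : compact K -> compact K' -> compact (K `&` K').
Proof.
move=> cK cK'; apply: compact_closedI => //; apply: compact_closed => //.
by case: (ampleP G).
Qed.

Lemma germ_zero0 u : germ_zero u 0.
Proof.
have [K [oK cK Ku _]] := compact_open_nbhs (filterT : nbhs u setT).
by exists K; split.
Qed.

Lemma germ_zeroB u m n : germ_zero u m -> germ_zero u n -> germ_zero u (m - n).
Proof.
move=> [K [oK cK Ku Km]] [K' [oK' cK' Ku' Kn]]; exists (K `&` K').
have oI : open (K `&` K') by exact: openI.
have cI := compact_objI cK cK'; split => //.
rewrite modBr -(gunit_subset oI cI oK cK)// modactA Km mod0r.
rewrite (gunit_subset oI cI oK cK)// -(gunit_subset oI cI oK' cK')//.
by rewrite modactA Kn mod0r subr0.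
Qed.

Lemma germ_zeroN u m : germ_zero u (- m) -> germ_zero u m.
Proof. by move=> Nm; rewrite -[m]opprK -sub0r; apply: germ_zeroB => //; exact: germ_zero0. Qed.

Lemma germ0_zero u f m : germ u f 0 -> germ_zero u (modact f m).
Proof.
move=> /germ0P /galg_vanish [K [oK cK Ku Kf]]; exists K; split => //.
by rewrite -modactA Kf mod0l.
Qed.

(** Multiplying [f] on the right by [gunit R K] does not change its germ, and the product kills
    [n]. *)
Lemma germ_zero_act u f s n : germ u f s -> germ_zero u n ->
  germ_zero u (modact f n).
Proof.
move=> fs [K [oK cK Ku Kn]].
have fK : germ u (f - rmul f (gunit R K)) 0.
  rewrite -(subrr s) -[X in germ _ _ (_ - X)]mulr1; apply: germB => //.
  by apply: germM => //; exact: germ_gunit.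
by have := germ0_zero n fK; rewrite modBl modactA Kn mod0r subr0.
Qed.

(** [s] acts through a chosen function with germ [s]. Two such functions differ by one of germ 0,
    which maps [M] into [germ_zero u], so the choice is harmless modulo these elements. *)
Lemma stalk_module u : exists (V : lmodType (gring R (isotropy u))) (p : M -> V),
  [/\ zmod_morphism p, forall v, exists m, p m = v,
      forall m, p m = 0 <-> germ_zero u m &
      forall f s m, germ u f s -> p (modact f m) = s *: p m].
Proof.
have [F Fs] := choice (@germ_ex R G u).
pose act s m := modact (F s) m.
have FB f h m : germ u (f - h) 0 -> germ_zero u (modact f m - modact h m).
  by move=> fh; rewrite -modBl; exact: germ0_zero.
have germ_eq f h s : germ u f s -> germ u h s -> germ u (f - h) 0.
  by move=> fs hs; rewrite -(subrr s); exact: germB.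
have [|||||||V [p [pB psurj p0 pact]]] := @quotient_module _ M (germ_zero u) act.
- exact: germ_zero0.
- exact: germ_zeroB.
- by move=> s m; exact: germ_zero_act.
- move=> s t m; rewrite /act -modactA; apply: FB; apply: germ_eq (Fs _) _.
  exact: germM.
- move=> m; have [K [oK cK Ku _]] := compact_open_nbhs (filterT : nbhs u setT).
  have FK : germ_zero u (modact (F 1) m - modact (gunit R K) m).
    by apply: FB; apply: germ_eq (Fs _) _; exact: germ_gunit.
  have Km : germ_zero u (modact (gunit R K) m - m).
    exists K; split => //; rewrite modBr -modactA.
    by rewrite (gunit_subset oK cK oK cK)// subrr.
  rewrite -(subrKA (modact (gunit R K) m)).
  rewrite -[modact (gunit R K) m - m]opprK; apply: germ_zeroB => //.
  by apply: germ_zeroN; rewrite opprK.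
- move=> s t m; rewrite /act -modactDl; apply: FB; apply: germ_eq (Fs _) _.
  exact: germD.
- by move=> s m n; rewrite /act modBr subrr; exact: germ_zero0.
exists V, p; split => // f s m fs; rewrite -pact; apply/eqP.
by rewrite -subr_eq0 -pB; apply/eqP/p0/FB; exact: germ_eq fs (Fs _).
Qed.

(** If [m] vanishes in every stalk, compactness covers the domain of each bisection [B] by finitely
    many [K] with [gunit R K] killing [m]. Cutting [B] along these sets shows that its
    characteristic function kills [m]. *)
Lemma stalk_neq0 : (exists f m, modact f m <> 0) ->
  exists u m, ~ germ_zero u m.
Proof.
move=> [f [m fm]]; apply: contrapT => allN; apply: fm.
have {}allN u : germ_zero u m.
  by apply: contrapT => Nm; apply: allN; exists u, m.
elim/galg_ind: f => [|a B f bB IH]; first exact: mod0l.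
rewrite modactDl IH addr0 => {f IH}.
have [oB cB dB rB] := bB.
pose P K := [/\ open K, compact K & modact (gunit R K) m = 0].
have [|v _|s sP Bs] := @compact_seq_cover _ (@gdom G @` B) P.
- apply: continuous_compact => //; apply: continuous_subspaceT => ?.
  exact: gdom_continuous.
- have [K [oK cK Kv Km]] := allN v; exists K => //.
  exact: open_nbhs_nbhs.
elim: s B bB sP Bs {oB cB dB rB} => [|K s IHs] B bB sP Bs.
  rewrite (_ : a *: _ = 0) ?mod0l//; apply: galg_eq => c.
  rewrite galgZE gindE//; case: (boolP (c \in B)) => [/set_mem Bc|]; last by rewrite mulr0.
  by have [|X] := Bs (gdom c); [exists c|].
have [oK cK Km] : P K by apply: sP; rewrite /= inE eqxx.
have oBK : open (B `&` @gdom G @^-1` K).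
  case: bB => oB _ _ _; apply: openI => //; apply: open_comp => // ? _.
  exact: gdom_continuous.
have oBDK : open (B `\` (B `&` @gdom G @^-1` K)).
  case: bB => oB _ _ _; rewrite setDIr setDv set0U setDE; apply: openI => //.
  apply: (@open_comp _ _ (@gdom G) (~` K)); first by move=> ? _; exact: gdom_continuous.
  apply: closed_openC; apply: compact_closed => //.
  by case: (ampleP G).
have bB1 := bisectionD bB oBK oBDK.
(* The part of [B] with domain in [K] is a right multiple of [gunit R K]; the rest is covered by the
   remaining sets. *)
have -> : a *: gind R B = rmul (a *: gind R B) (gunit R K) +
    a *: gind R (B `\` (B `&` @gdom G @^-1` K)).
  have bK := bisection_unit oK cK.
  apply: galg_eq => c; rewrite galgDE !galgZE !gindE//.
  have [Kc|Kc] := pselect (K (gdom c)).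
    rewrite (@mul_gind _ _ _ _ (gid (gdom c)))//; last by rewrite gdom_id.
    have idV : ginv (gid (gdom c)) = gid (gdom c).
      have := gmul_idl (ginv (gid (gdom c))).
      by rewrite gran_inv gdom_id gmulV gran_id.
    rewrite idV gmul_idr galgZE gindE//.
    rewrite [X in _ + _ * X](_ : _ = 0) ?mulr0 ?addr0//.
    by case: (boolP (c \in _)) => // /set_mem [Bc []].
  rewrite mul_gind0// => [|_ [v Kv <-]]; last by rewrite gdom_id => vc; rewrite vc in Kv.
  rewrite add0r; congr (_ * _%:R); congr nat_of_bool.
  by apply/idP/idP => /set_mem Bc; apply/mem_set; [split => // -[]|case: Bc].
rewrite modactDl modactA Km mod0r add0r; apply: IHs => //.
  by move=> X Xs; apply: sP; rewrite /= inE Xs orbT.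
move=> _ [c [Bc nBc] <-]; have [|X] := Bs (gdom c); first by exists c.
rewrite /= inE => /orP[/eqP-> Kc|Xs Xc]; last by exists X.
by exfalso; apply: nBc.
Qed.

End Stalks.

(** * Induced modules *)

Section StarComponents.
Variables (R : comPzRingType) (G : topGroupoid) (u : obj G).
Local Notation RG := (gring R (isotropy u)).
Implicit Types (x y : star u) (g k : isotropy u) (z : fmod R (star u)) (s : RG).

Lemma star_rmul1 x : star_rmul x 1%g = x.
Proof. by apply: val_inj; have := gmul_idr (val x); rewrite star_dom. Qed.

Lemma star_rmulK g : cancel (@star_rmul G u ^~ g) (@star_rmul G u ^~ g^-1%g).
Proof.
by move=> x; rewrite -star_rmulA mulgV star_rmul1.
Qed.

Lemma star_rmulVK g : cancel (@star_rmul G u ^~ g^-1%g) (@star_rmul G u ^~ g).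
Proof. by move=> x; rewrite -{2}[g]invgK star_rmulK. Qed.

Lemma star_rmul_inj x : injective (star_rmul x).
Proof.
move=> g k /(congr1 val) /= gk; apply: val_inj.
have xd (h : isotropy u) : gdom (val x) = gran (val h).
  by rewrite star_dom isotropy_ran.
by rewrite -(gmulKV (xd g)) gk (gmulKV (xd k)).
Qed.

Lemma star_quot x y : gran (val x) = gran (val y) ->
  exists g : isotropy u, y = star_rmul x g.
Proof.
move=> xy.
have [||g gE] := @isotropy_ex _ u (gmul (ginv (val x)) (val y)).
- by rewrite gdom_mul ?gdom_inv// star_dom.
- by rewrite gran_mul ?gdom_inv// gran_inv star_dom.
by exists g; apply: val_inj; rewrite /= gE gmulVKV.
Qed.

Lemma pcomp_finsupp x z : Defs.finsupp (fun g => z (star_rmul x g) : R^o).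
Proof.
apply/asboolP; apply: (@finite_preimage _ _ [set y | z y != 0] (star_rmul x)).
  by move=> g k _ _; exact: star_rmul_inj.
exact: fmod_finite z.
Qed.

(* The coordinate of z along x, for R[star u] as a free right module over the
   group ring with basis a transversal of the orbits of the isotropy group. *)
Definition pcomp x z : RG := Fmod (pcomp_finsupp x z).

Lemma pcompE x z g : pcomp x z g = z (star_rmul x g). Proof. by []. Qed.

Lemma pcompD x : {morph pcomp x : z w / z + w}.
Proof. by move=> z w; apply: fmod_eq => g. Qed.

Lemma pcompZ x a z : pcomp x (a *: z) = a *: pcomp x z.
Proof. by apply: fmod_eq => g. Qed.

Lemma pcomp0 x : pcomp x 0 = 0.
Proof. by apply: fmod_eq => g. Qed.

Lemma gractE z s x :
  gract z s x = \sum_(k \in [set: isotropy u]) s k * z (star_rmul x k^-1%g).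
Proof.
apply: (flin_action_coef (F' := fun x k => star_rmul x k^-1%g)).
  exact: star_rmulK.
exact: star_rmulVK.
Qed.

Lemma pcomp_gract x z s : pcomp x (gract z s) = pcomp x z * s.
Proof.
apply: fmod_eq => g; rewrite pcompE gractE gring_mulE.
by apply: eq_fsbigr => k _; rewrite pcompE star_rmulA.
Qed.

Lemma pcomp_delta x : pcomp x (fdelta x) = 1.
Proof.
apply: fmod_eq => g; rewrite pcompE !fdeltaE; congr (_ %:R); congr nat_of_bool.
by rewrite -{2}(star_rmul1 x) (inj_eq (@star_rmul_inj x)).
Qed.

Lemma gract_delta x s : gract (fdelta x) s =
  flin (fun g => fdelta (star_rmul x g)) s.
Proof. by rewrite /gract flin_delta. Qed.

Lemma gract_delta_rmul x s g : gract (fdelta x) s (star_rmul x g) = s g.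
Proof. by rewrite gract_delta flin_coef_inj//; exact: star_rmul_inj. Qed.

Lemma gract_delta0 x s y : gran (val y) <> gran (val x) ->
  gract (fdelta x) s y = 0.
Proof.
move=> yx; rewrite gract_delta flin_coef fsbig1// => g _; rewrite fdeltaE.
by case: eqP => [yE|_]; [case: yx; rewrite yE star_rmul_ran|rewrite mulr0].
Qed.

Lemma gract_deltaZ x a g : gract (fdelta x) (a *: (fdelta g : RG)) =
  a *: fdelta (star_rmul x g).
Proof. by rewrite gract_delta linearZ /= flin_delta. Qed.

(** Two arrows of [star u] are in one orbit of the isotropy group exactly when their ranges agree,
    so [rep] picks one basis vector for each range in [D]. *)
Lemma star_decomp (rep : obj G -> star u) (D : {fset obj G}) z :
  (forall v, v \in D -> gran (val (rep v)) = v) ->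
  (forall x, z x != 0 -> gran (val x) \in D) ->
  z = \sum_(v <- D) gract (fdelta (rep v)) (pcomp (rep v) z).
Proof.
move=> repD zD; apply: fmod_eq => y; rewrite fmod_sumE.
have other v : v \in D -> v <> gran (val y) ->
    gract (fdelta (rep v)) (pcomp (rep v) z) y = 0.
  by move=> vD vy; apply: gract_delta0; rewrite repD// => yv; exact: vy.
have [yD|yD] := boolP (gran (val y) \in D); last first.
  rewrite big_seq big1 => [|v vD].
    by apply/eqP; apply: contraNT yD; exact: zD.
  by apply: other => // vy; rewrite -vy vD in yD.
rewrite (big_fsetD1 (gran (val y)))//= big_seq big1 ?addr0.
  have [g yE] := star_quot (repD _ yD); set x := rep _ in yE *.
  by rewrite yE gract_delta_rmul pcompE.
move=> v; rewrite in_fsetD1 => /andP[/eqP vy vD]; exact: other.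
Qed.

End StarComponents.

(** * Coordinates and simplicity of induced modules *)

Section InducedModules.
Variables (R : comPzRingType) (G : ampleGroupoid) (u : obj G).
Local Notation A := (galg R G).
Local Notation RG := (gring R (isotropy u)).
Variable V : lmodType RG.
Local Notation tns := (@tens RG (fmod R (star u)) (@gract G R u) V).
Implicit Types (x y : star u) (g : isotropy u) (z : fmod R (star u)) (s : RG)
  (f h : A) (v w : V) (t : induced V) (B : set (arr G)) (b c : arr G).

(** The induced module is a direct sum of copies of [V], one for each orbit in [star u]; this is the
    projection onto the copy of the orbit of [x], identified with [V] through [x]. *)
Definition tau x : induced V -> V :=
  tensor_lift (fun z v => pcomp x z *: v).

Let tau_Dl x v : {morph (fun z => pcomp x z *: v) : z w / z + w}.
Proof. by move=> z w; rewrite pcompD scalerDl. Qed.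
Let tau_Dr x z : {morph (fun v => pcomp x z *: v) : v w / v + w}.
Proof. by move=> v w; rewrite scalerDr. Qed.
Let tau_bal x z s v : pcomp x (gract z s) *: v = pcomp x z *: (s *: v).
Proof. by rewrite pcomp_gract scalerA. Qed.

Lemma tau_tens x z v : tau x (tns z v) = pcomp x z *: v.
Proof. exact: (tensor_lift_tens (tau_Dl x) (tau_Dr x) (tau_bal x)). Qed.

Lemma tauB x : zmod_morphism (tau x).
Proof.
exact: (tensor_lift_is_zmod_morphism (tau_Dl x) (tau_Dr x) (tau_bal x)).
Qed.

Lemma tau0 x : tau x 0 = 0.
Proof. by rewrite -(subrr 0) tauB subrr. Qed.

Lemma tens0l v : tns 0 v = 0.
Proof. by apply: (addrI (tns 0 v)); rewrite -tensDl !addr0. Qed.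
Lemma tens0r z : tns z 0 = 0.
Proof. by apply: (addrI (tns z 0)); rewrite -tensDr !addr0. Qed.
Lemma tensNr z v : tns z (- v) = - tns z v.
Proof. by apply: (addrI (tns z v)); rewrite -tensDr !subrr tens0r. Qed.
Lemma tensBr z v w : tns z (v - w) = tns z v - tns z w.
Proof. by rewrite tensDr tensNr. Qed.

Lemma tau_eq0 t : (forall x, tau x t = 0) -> t = 0.
Proof.
have [rep repP] : exists rep : obj G -> star u, forall x,
    gran (val (rep (gran (val x)))) = gran (val x).
  have /choice [rep repP] : forall v : obj G, exists x : star u,
      forall y : star u, gran (val y) = v -> gran (val x) = v.
    move=> v; have [[y yv]|nv] := pselect (exists y : star u, gran (val y) = v).
      by exists y.
    by exists (star_id u) => y yv; case: nv; exists y.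
  by exists rep => x; exact: repP.
pose good (D : {fset obj G}) := forall v : obj G, v \in D -> gran (val (rep v)) = v.
(* The expansion is stated for every larger admissible [D'], so that those of two tensors can be
   compared on a common index set in the induction. *)
suff [D [gD DE]] : exists D, good D /\ forall D', good D' -> (D `<=` D')%fset ->
    t = \sum_(v <- D') tns (fdelta (rep v)) (tau (rep v) t).
  move=> t0; rewrite (DE D gD (fsubset_refl _)) big1// => v _.
  by rewrite t0 tens0r.
elim/tensor_ind: t => [|t1 t2 [D1 [gD1 E1]] [D2 [gD2 E2]]|z v].
- exists fset0; split => // D' _ _; rewrite big1// => v _.
  by rewrite tau0 tens0r.
- exists (D1 `|` D2)%fset; split.
    by move=> v; rewrite in_fsetU => /orP[/gD1|/gD2].
  move=> D' gD' /[dup] /(fsubset_trans (fsubsetUl _ _)) DD1.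
  move=> /(fsubset_trans (fsubsetUr _ _)) DD2.
  rewrite {1}(E1 D' gD' DD1) {1}(E2 D' gD' DD2) -sumrB.
  by apply: eq_bigr => v _; rewrite tauB tensBr.
- exists [fset gran (val x) | x in fsupp z]%fset; split.
    by move=> w /imfsetP[x _ ->]; exact: repP.
  move=> D' gD' zD.
  rewrite {1}(@star_decomp _ _ _ rep D' z gD') => [|x zx]; last first.
    by apply: (fsubsetP zD); apply/imfsetP; exists x => //=; rewrite mem_fsupp.
  rewrite (big_morph (tns^~ v) (tensDl _ v) (tens0l v)).
  by apply: eq_bigr => w _; rewrite tens_bal tau_tens.
Qed.

Lemma ind_actE f z v : modact f (tns z v : induced V) = tns (sact f z) v.
Proof. exact: ind_act_tens. Qed.

(** The elements [pcomp y (lact f x)] are the entries of the matrix by which [f] acts on the free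
    right module; [f] annihilates the induced module when every entry annihilates [V]. *)
Lemma ind_annP f : annihilator (fun f t => modact f t : induced V) f <->
  forall x y v, pcomp y (lact f x) *: v = 0.
Proof.
split=> [annf x y v|f0 t].
  have := annf (tns (fdelta x) v); rewrite ind_actE /sact flin_delta.
  by move=> /(congr1 (tau y)); rewrite tau_tens tau0.
elim/tensor_ind: t => [|t1 t2 IH1 IH2|z v]; first exact: (action0r modactDr).
  by rewrite (actionBr modactDr) IH1 IH2 subrr.
rewrite ind_actE; apply: tau_eq0 => y; rewrite tau_tens.
elim/fmod_ind: z => [|a x z IHz]; first by rewrite /sact linear0 pcomp0 scale0r.
rewrite /sact linearD linearZ /= flin_delta pcompD pcompZ scalerDl scale_scale.
by rewrite f0 (action0r (@ractDr _ _ V)) add0r.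
Qed.

Lemma lact_gind (a : R) B b x : bisection B -> B b -> gdom b = gran (val x) ->
  lact (a *: gind R B) x = a *: fdelta (star_lmul b x).
Proof.
move=> bB Bb bx; apply: fmod_eq => y; rewrite lactE; last exact: galg_dfinite.
rewrite -[LHS]/(a * gind R B _) gindE// fmodZE fdeltaE.
congr (_ * _%:R); congr nat_of_bool; apply/idP/eqP => [/set_mem By|->].
  have yx : gdom (val y) = gdom (val x) by rewrite !star_dom.
  apply: val_inj; rewrite star_lmulE//.
  rewrite (_ : b = gmul (val y) (ginv (val x))) ?gmulVK//.
  have [_ _ dB _] := bB; apply: dB; rewrite ?inE//.
  by rewrite gdom_mul ?gran_inv// gdom_inv.
by rewrite inE star_lmulE// gmulK.
Qed.

Lemma ind_act_gind (a : R) B b x v : bisection B -> B b ->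
  gdom b = gran (val x) ->
  modact (a *: gind R B) (tns (fdelta x) v : induced V) =
    tns (a *: fdelta (star_lmul b x)) v.
Proof.
by move=> bB Bb bx; rewrite ind_actE /sact flin_delta (lact_gind a bB Bb).
Qed.

(** A bisection through the inverse of [y] carries the component of [t] in the orbit of [y] to the
    one at the identity. If its domain avoids the finitely many other ranges occurring in [t], it
    kills the other components. *)
Lemma ind_act_local t y : exists F : set (obj G),
  [/\ finite_set F, ~ F (gran (val y)) & forall B, bisection B ->
    B (ginv (val y)) -> (forall b, B b -> ~ F (gdom b)) ->
    modact (gind R B) t = tns (fdelta (star_id u)) (tau y t)].
Proof.
elim/tensor_ind: t => [|t1 t2 [F1 [fF1 nF1 E1]] [F2 [fF2 nF2 E2]]|z v].
- exists set0; split => // B _ _ _.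
  by rewrite tau0 tens0r (action0r modactDr).
- exists (F1 `|` F2); split; [by rewrite finite_setU|by case|].
  move=> B bB By BF.
  have BF1 b : B b -> ~ F1 (gdom b) by move=> Bb Fb; apply: (BF b Bb); left.
  have BF2 b : B b -> ~ F2 (gdom b) by move=> Bb Fb; apply: (BF b Bb); right.
  rewrite (actionBr modactDr) (E1 B bB By BF1) (E2 B bB By BF2).
  by rewrite tauB tensBr.
exists ([set gran (val x) | x in [set x | z x != 0]] `\ gran (val y)).
split; [|by move=> [_ /(_ erefl)]|move=> B bB By BF].
  by apply: finite_setD; apply: finite_image; exact: fmod_finite.
rewrite ind_actE tau_tens -tens_bal; congr (tns _ _).
apply: fmod_eq => w; rewrite /sact flin_coef.
(* By injectivity of [gdom] on [B], only the arrow of [B] through the inverse of [y] can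
   contribute. *)
have term x : z x * lact (gind R B) x w != 0 ->
    gmul (val w) (ginv (val x)) = ginv (val y).
  have [->|zx] := eqVneq (z x) 0; first by rewrite mul0r eqxx.
  rewrite lactE; last exact: galg_dfinite.
  rewrite gindE//; case: (boolP (_ \in _)); last by rewrite mulr0 eqxx.
  move=> /set_mem Bwx _; have wx : gdom (val w) = gran (ginv (val x)).
    by rewrite gran_inv !star_dom.
  have [_ _ dB _] := bB; apply: dB; rewrite ?inE//.
  rewrite gdom_mul// !gdom_inv; apply: contrapT => xy.
  apply: (BF _ Bwx); rewrite gdom_mul// gdom_inv; split => //.
  by exists x.
have [wu|wu] := pselect (gran (val w) = gran (val (star_id u))); last first.
  rewrite gract_delta0// fsbig1// => x _; apply/eqP/negPn/negP => /term wxy.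
  apply: wu; have := congr1 (@gran G) wxy.
  by rewrite gran_mul ?gran_inv ?star_dom//= gran_id.
have [g wE] := star_quot (esym wu).
have wg : val w = val g by rewrite wE /= -[RHS]gmul_idl isotropy_ran.
rewrite [in RHS]wE gract_delta_rmul pcompE.
rewrite -(@fsbig_widen _ _ _ _ [set star_rmul y g])//.
- rewrite fsbig_set1 lactE; last exact: galg_dfinite.
  rewrite gindE// (_ : gmul _ _ = ginv (val y)) ?mem_set ?mulr1//=.
  rewrite wg ginvM ?star_dom ?isotropy_ran// gmulVKV//.
  by rewrite isotropy_ran gran_inv star_dom.
- move=> x [_ xn]; apply/eqP/negPn/negP => /term wxy; apply: xn.
  apply: val_inj; rewrite /= -wg -[val y]ginvK -wxy ginvM; last first.
    by rewrite gran_inv !star_dom.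
  by rewrite ginvK gmulVK// !star_dom.
Qed.

(** A nonzero submodule contains some nonzero vector placed at the identity arrow, by
    [ind_act_local]. The vectors so contained form a submodule [P] of [V], hence all of [V], and
    bisections carry them to every arrow of [star u]. *)
Lemma ind_simple : simple_module (fun s v => s *: v : V) ->
  simple_module (fun f t => modact f t : induced V).
Proof.
move=> [[s0 [v0 sv0]] simV].
have act_id (a : R) x v : exists f,
    modact f (tns (fdelta (star_id u)) v : induced V) = tns (a *: fdelta x) v.
  have [B [bB Bx]] := bisection_ex (val x); exists (a *: gind R B).
  have xd : gdom (val x) = gran (val (star_id u)) by rewrite star_dom gran_id.
  rewrite (ind_act_gind a _ bB Bx xd); congr (tns (_ *: fdelta _) _).
  by apply: val_inj; rewrite star_lmulE//= -[RHS]gmul_idr star_dom.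
split.
  have [f fE] := act_id 1 (star_id u) v0.
  exists f, (tns (fdelta (star_id u)) v0); rewrite fE scale1r.
  move=> /(congr1 (tau (star_id u))); rewrite tau_tens tau0 pcomp_delta scale1r.
  by move=> v00; apply: sv0; rewrite v00 scaler0.
move=> N sN; have [N0 NB Nact] := sN.
have [NT|] := pselect (N `<=` [set 0]).
  by left; apply/seteqP; split => // _ ->.
move=> /existsNP [t /not_implyP [Nt t0]]; right.
have [y ty] : exists y, tau y t <> 0.
  by apply/existsNP => tau0; apply: t0; exact: tau_eq0.
have [F [finF Fy Ft]] := ind_act_local t y.
have [|B [bB By BF]] := bisection_dom_avoid finF (c := ginv (val y)).
  by rewrite gdom_inv.
pose P := [set v | N (tns (fdelta (star_id u)) v)].
have gP : gmodule P.
  split; rewrite /P /=; first by rewrite tens0r.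
    by move=> v w Pv Pw; rewrite tensBr; exact: NB.
  move=> s v Pv; elim/fmod_ind: s => [|a g s IHs]; first by rewrite scale0r tens0r.
  rewrite scalerDl tensDr; apply: (submoduleD sN) IHs.
  rewrite -tens_bal gract_deltaZ.
  by have [f <-] := act_id a (star_rmul (star_id u) g) v; exact: Nact.
have [P0|PT] := simV _ gP.
  exfalso; apply: ty; have : P (tau y t) by rewrite /P /= -(Ft B bB By BF); exact: Nact.
  by rewrite P0.
apply/seteqP; split => // t' _.
elim/tensor_ind: t' => [//|t1 t2|z v]; first exact: NB.
have Pv : P v by rewrite PT.
elim/fmod_ind: z => [|a x z IHz]; first by rewrite tens0l.
rewrite tensDl; apply: (submoduleD sN) IHz.
by have [f <-] := act_id a x v; exact: Nact.
Qed.

End InducedModules.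

(** * Annihilators *)

Section AnnihilatorOfInduced.
Variables (R : comPzRingType) (G : ampleGroupoid) (M : rngModType (galg R G)).
Local Notation A := (galg R G).
Hypothesis simM : simple_module (@modact A M).

(** The algebra may lack a unit, so A m is not known at once to be nonzero. The elements killed by
    the algebra form a proper submodule, hence 0; so A m is nonzero and equals [M]. *)
Lemma simple_transitive (m n : M) : m <> 0 -> exists f : A, modact f m = n.
Proof.
move=> m0; have [[f0 [n0 fn0]] sub] := simM.
have mod0r (f : A) : modact f (0 : M) = 0 by exact: (action0r modactDr).
have modBr (f : A) (x y : M) : modact f (x - y) = modact f x - modact f y.
  exact: (actionBr modactDr).
pose K : set M := [set x | forall f : A, modact f x = 0].
have K0 : K = [set 0].
  have [//|//|KT] := sub K.
    split => [f|x y Kx Ky f|s x Kx f]; first exact: mod0r.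
      by rewrite modBr Kx Ky subrr.
    by rewrite Kx mod0r.
  by exfalso; apply: fn0; have : K n0 by rewrite KT.
pose N : set M := [set x | exists f : A, modact f m = x].
have [|N0|NT] := sub N; last by have : N n by rewrite NT.
- split.
  + by exists 0; exact: (action0l modactDl).
  + move=> _ _ [f <-] [h <-]; exists (f - h); exact: (actionBl modactDl).
  + by move=> s _ [f <-]; exists (rmul s f); exact: modactA.
- exfalso; apply: m0; have : K m.
    by move=> f; have : N (modact f m) by [exists f]; rewrite N0.
  by rewrite K0.
Qed.

Variables (u : obj G) (V : lmodType (gring R (isotropy u))) (p : M -> V).
Hypotheses (pB : zmod_morphism p) (psurj : forall v, exists m, p m = v)
  (V0 : exists v : V, v <> 0)
  (pgerm : forall f s m, germ u f s -> p (modact f m) = s *: p m).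
Implicit Types (x y : star u) (f h : A) (m n : M) (v w : V).

Let p0 : p 0 = 0. Proof. by rewrite -(subrr 0) pB subrr. Qed.

Lemma pcomp_lactE f x y (g : isotropy u) : pcomp y (lact f x) g =
  f (gmul (gmul (val y) (val g)) (ginv (val x))).
Proof. by rewrite pcompE lactE//; exact: galg_dfinite. Qed.

(** With [B] through the inverse of [y] and [B'] through [x], the product takes at g the value f(y g
    x^-1), which is the matrix entry. *)
Lemma germ_conjugate f x y : exists B B' : set (arr G),
  germ u (rmul (rmul (gind R B) f) (gind R B')) (pcomp y (lact f x)).
Proof.
have [B [bB By]] := bisection_ex (ginv (val y)).
set h := rmul (gind R B) f.
(* [h] is supported on finitely many arrows with range [u]. Their sources other than the range of
   [x] are kept out of the range of [B'], so that the product vanishes on arrows from other units to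
   [u]. *)
pose F := (@gdom G @` [set c | gran c = u /\ h c != 0]) `\ gran (val x).
have finF : finite_set F.
  by apply: finite_setD; apply: finite_image; exact: galg_ran_finite.
have [|B' [bB' B'x B'F]] := bisection_ran_avoid finF (c := val x).
  by move=> [_ /(_ erefl)].
exists B, B'; split => [g|c cr cd].
  have gx : gdom (val g) = gran (ginv (val x)).
    by rewrite gran_inv star_dom isotropy_dom.
  rewrite (@mul_gind _ _ _ _ (val x))//; last by rewrite star_dom isotropy_dom.
  rewrite (@gind_mul _ _ _ _ (ginv (val y)))//; last first.
    by rewrite gran_mul// gran_inv star_dom isotropy_ran.
  by rewrite ginvK pcomp_lactE gmulA// star_dom isotropy_ran.
have [[b [B'b bc]]|nb] := pselect (exists b, B' b /\ gdom b = gdom c); last first.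
  by apply: mul_gind0 => // b B'b bc; apply: nb; exists b.
rewrite (@mul_gind _ _ _ _ b)//; apply: contrapT => /eqP hcb; apply: cd.
have cb : gdom c = gran (ginv b) by rewrite gran_inv.
suff bx : b = val x by rewrite -bc bx star_dom.
have [_ _ _ rB'] := bB'; apply: rB'; rewrite ?inE//.
apply: contrapT => bx; apply: (B'F b) => //; split => //.
exists (gmul c (ginv b)); last by rewrite gdom_mul// gdom_inv.
by split => //; rewrite gran_mul.
Qed.

(* Modulo functions vanishing on the fibre of the range map over u, f is the sum
   over the sources v of the arrows it charges there of its parts with source
   v; each is an element of the group ring times a bisection from v to u. *)
Lemma ind_ann_germ f m : annihilator (fun f t => modact f t : induced V) f ->
  p (modact f m) = 0.
Proof.
move=> /ind_annP annf.
have finD : finite_set (@gdom G @` [set c | gran c = u /\ f c != 0]).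
  by apply: finite_image; exact: galg_ran_finite.
pose D := fset_set (@gdom G @` [set c | gran c = u /\ f c != 0]).
have memD c : gran c = u -> f c != 0 -> gdom c \in D.
  by move=> cr fc; rewrite in_fset_set//; apply/mem_set; exists c.
(* For [v] in [D], [rep v] is an arrow from [u] to [v]; elsewhere [star_id u] is a default value. *)
have /choice [rep repP] : forall v : obj G, exists x : star u,
    v \in D -> gran (val x) = v.
  move=> v; have [vD|_] := boolP (v \in D); last by exists (star_id u).
  move: vD; rewrite in_fset_set// => /set_mem [c [cr _] <-].
  have cu : gdom (ginv c) == u by rewrite gdom_inv cr.
  by exists (exist _ (ginv c) cu) => _; rewrite /= gran_inv.
(* The germ of [F v] at g is f(g (rep v)^-1). Multiplying by a bisection through the inverse of
   [rep v] restores the values of [f] on arrows from [v] to [u]. *)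
have [F FP] := choice (fun v : obj G => germ_ex (pcomp (star_id u) (lact f (rep v)))).
have [B BP] := choice (fun v : obj G => bisection_ex (ginv (val (rep v)))).
pose f' := \sum_(v <- D) rmul (F v) (gind R (B v)).
have part_eq c : gran c = u -> gdom c \in D ->
    rmul (F (gdom c)) (gind R (B (gdom c))) c = f c.
  move=> cr cD; have [bB Bx] := BP (gdom c); have xc := repP _ cD.
  rewrite (mul_gind _ bB Bx) ?gdom_inv// ginvK.
  have [||g gE] := @isotropy_ex _ u (gmul c (val (rep (gdom c)))).
  - by rewrite gdom_mul// star_dom.
  - by rewrite gran_mul.
  rewrite -gE (FP _).1 pcomp_lactE /= gE; congr (f _).
  have := gmul_idl (gmul c (val (rep (gdom c)))).
  by rewrite gran_mul// cr => ->; rewrite gmulK.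
have part_neq (v : obj G) c : v \in D -> gran c = u -> gdom c <> v ->
    rmul (F v) (gind R (B v)) c = 0.
  move=> vD cr cv; have [bB Bx] := BP v.
  have [[b [Bb bc]]|nb] := pselect (exists b, B v b /\ gdom b = gdom c);
      last by apply: mul_gind0 => // b Bb bc; apply: nb; exists b.
  rewrite (mul_gind _ bB Bb bc); apply: (FP v).2; first by rewrite gran_mul ?gran_inv.
  rewrite gdom_mul ?gran_inv// gdom_inv => br; apply: cv.
  rewrite -bc (_ : b = ginv (val (rep v))) ?gdom_inv ?repP//.
  have [_ _ _ rB] := bB; apply: rB; rewrite ?inE//.
  by rewrite br gran_inv star_dom.
have ff' : germ u (f - f') 0.
  apply/germ0P => c cr; rewrite galgBE galg_sumE.
  have [cD|cD] := boolP (gdom c \in D).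
    rewrite (big_fsetD1 (gdom c))// part_eq// big_seq big1 /= ?addr0 ?subrr//.
    move=> v; rewrite in_fsetD1 => /andP[/eqP vc vD].
    by apply: part_neq => // cv; exact: vc.
  rewrite big_seq big1 ?subr0 => [|v vD].
    by apply/eqP; apply: contraNT cD; exact: memD.
  by apply: part_neq => // cv; rewrite cv vD in cD.
have pD : {morph p : m n / m + n}.
  by move=> m' n; rewrite -[n in LHS]opprK pB -[- n]add0r pB p0 sub0r opprK.
have -> : modact f m = modact (f - f') m + modact f' m.
  by rewrite -modactDl subrK.
rewrite pD (pgerm _ ff') scale0r add0r.
rewrite (big_morph (@modact _ M^~ m) (modactDl m) (action0l modactDl m)).
rewrite (big_morph p pD p0) big1// => v _.
(* The germ of [F v] is a matrix entry of [f], which annihilates [V]. *)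
by rewrite modactA (pgerm _ (FP v)) annf.
Qed.

Lemma annihilator_induced : annihilator (@modact A M) =
  annihilator (fun f t => modact f t : induced V).
Proof.
apply/seteqP; split => f annf.
  apply/ind_annP => x y v; have [m <-] := psurj v.
  have [B [B' gf]] := germ_conjugate f x y.
  by rewrite -(pgerm _ gf) !modactA annf (action0r modactDr).
move=> m; apply: contrapT => fm; have [v v0] := V0.
have [n pn] := psurj v; have [h hE] := simple_transitive n fm.
apply: v0; rewrite -pn -hE -modactA; apply: ind_ann_germ => t.
by rewrite modactA annf (action0r modactDr).
Qed.

End AnnihilatorOfInduced.

(** * Primitive ideals as annihilators of induced modules *)

Lemma annihilator_two_sided (S : rngType) (M : rngModType S) :
  two_sided_ideal (annihilator (@modact S M)).
Proof.
split=> [m|a b Ia Ib m|s a Ia]; first exact: (action0l modactDl).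
  by rewrite (actionBl modactDl) Ia Ib subrr.
by split=> m; rewrite modactA ?Ia// (action0r modactDr).
Qed.

Lemma simple_quotient (R : comPzRingType) (H : groupType)
    (V : lmodType (gring R H)) (P : set V) : max_gmodule P ->
  exists (W : lmodType (gring R H)) (q : V -> W),
    [/\ zmod_morphism q, forall w, exists v, q v = w,
        forall s v, q (s *: v) = s *: q v, exists w : W, w <> 0 &
        simple_module (fun s w => s *: w : W)].
Proof.
move=> [gP PT maxP]; have [P0 PB Ps] := gP.
have [||||W [q [qB qsurj q0 qs]]] :=
    @quotient_module (gring R H) V P (fun s v => s *: v) P0 PB Ps.
- by move=> a b m; rewrite scalerA subrr.
- by move=> m; rewrite scale1r subrr.
- by move=> a b m; rewrite scalerDl subrr.
- by move=> a m n; rewrite scalerBr subrr.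
have [v Pv] : exists v, ~ P v.
  apply/existsNP => PV; apply: PT; apply/seteqP; split => // v _; exact: PV.
have qv : q v <> 0 by move/q0.
exists W, q; split => //; first by exists (q v).
split; first by exists 1, (q v); rewrite scale1r.
move=> N [N0 NB Ns]; have [||NP|NT] := maxP (q @^-1` N).
- split; rewrite /preimage /=.
  + by rewrite (q0 0).2.
  + by move=> m n Nm Nn; rewrite qB; exact: NB.
  + by move=> s m Nm; rewrite qs; exact: Ns.
- by move=> m /q0 qm; rewrite /preimage /= qm.
- left; apply/seteqP; split => [w Nw|_ ->//].
  have [m mw] := qsurj w; rewrite -mw; apply/q0; rewrite -NP.
  by rewrite /preimage /= mw.
- right; apply/seteqP; split => // w _; have [m <-] := qsurj w.
  by have : (q @^-1` N) m by rewrite NT.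
Qed.

Unset Implicit Arguments.

Theorem corollary9 (R : comPzRingType) (G : ampleGroupoid)
    (hR : artinian R)
    (hG : forall u : obj G,
      finite_set [set: isotropy u] \/
      [/\ locally_finite (isotropy u),
          forall g h : isotropy u, (g * h)%g = (h * g)%g &
          forall (g : isotropy u) (n : nat), has_order g n ->
            unit_mod (jacobson_radical R) n%:R])
    (I : set (galg R G)) :
  primitive_ideal I <->
  exists (u : obj G) (M : lmodType (gring R (isotropy u))),
    simple_module (fun (s : gring R (isotropy u)) (m : M) => s *: m) /\
    I = annihilator (fun (f : galg R G) (t : induced M) => modact f t).
Proof.
split=> [[_ [M [simM ->]]]|[u [V [simV ->]]]]; last first.
  split; first exact: (@annihilator_two_sided (galg R G) (induced V)).
  by exists (induced V); split => //; exact: ind_simple.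
have [u [m0 um0]] := stalk_neq0 simM.1.
have [V [p [pB psurj p0 pgerm]]] := stalk_module M u.
have V0 : exists v : V, v <> 0 by exists (p m0) => /p0.
have [P maxP] : exists P : set V, max_gmodule P.
  case: (hG u) => [finG|[locG comG ordG]]; first exact: max_gmodule_finite.
  exact: max_gmodule_locally_finite.
have [W [q [qB qsurj qs W0 simW]]] := simple_quotient maxP.
exists u, W; split => //.
apply: (annihilator_induced simM (p := q \o p)) => //.
- by move=> m n; rewrite /= pB qB.
- by move=> w; have [v <-] := qsurj w; have [m <-] := psurj v; exists m.
- by move=> f s m fs; rewrite /= (pgerm _ _ _ fs) qs.
Qed.
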